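(* Let $n\ge 2$ and $A=\{0,1,\dots,n-1\}$. Let the plaintext $X=X_1X_2\dots$ and the key sequence $Y=Y_1Y_2\dots$ be independent stationary ergodic processes with values in $A$, and let $Z=Z_1Z_2\dots$ be the ciphertext of the running-key cipher $Z_i=(X_i+Y_i)\bmod n$. Then for any $\varepsilon>0$ and $\delta>0$ there is an integer $n'$ such that, with probability 1, for any $t>n'$ and $Z_1Z_2\dots Z_t$ there exists a set $\Psi_t(Z)\subseteq A^t$ (depending on $Z_1\dots Z_t$) for which (i) $P(\Psi_t(Z))>1-\delta$; (ii) for any $x^1,x^2$ from $\Psi_t(Z)$, $$\frac1t\left|\log P(x^1\mid Z_1\dots Z_t)-\log P(x^2\mid Z_1\dots Z_t)\right|<\varepsilon;$$ (iii) $\liminf_{t\to\infty}\frac1t\log|\Psi_t(Z)|\ge h(X|Z)$; and for these sets, for almost all $Z_1Z_2\dots$, $$\liminf_{t\to\infty}\frac1t\log|\Psi_t(Z)|\ \ge\ h(X)+h(Y)-\log n.$$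
   Context: All logarithms are to base 2. For $x\in A^t$, $P(x\mid Z_1\dots Z_t)$ is the conditional probability that $X_1\dots X_t=x$ given $Z_1\dots Z_t$, and $P(\Psi_t(Z))$ is the probability, given $Z_1\dots Z_t$, that $X_1\dots X_t\in\Psi_t(Z)$. $|\Psi|$ denotes the cardinality of a finite set $\Psi$. For a stationary process $W=W_1W_2\dots$ with values in a finite alphabet $B$ and $m\ge 0$, put $$h_m(W)=-\frac{1}{m+1}\sum_{u\in B^{m+1}}P(W_1\dots W_{m+1}=u)\log P(W_1\dots W_{m+1}=u),\qquad h(W)=\lim_{m\to\infty}h_m(W)$$ (the limit exists). $h_m(X,Z)$ denotes this quantity for the joint process $((X_i,Z_i))_{i\ge1}$ with values in $A\times A$. The conditional entropy is $h_m(X|Z)=h_m(X,Z)-h_m(Z)$, $h(X|Z)=\lim_{m\to\infty}h_m(X|Z)$.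
   Formalization: As printed the claim is false in two places: here n' may depend on the realisation Z_1 Z_2 ... (with probability 1 there is n'), and (iii) is claimed only when Z is ergodic, which does not follow from X and Y being independent and ergodic. *)

(* Defs.v *)
From HB Require Import structures.
From mathcomp Require Import all_boot all_order all_algebra.
From mathcomp Require Import all_classical all_reals all_analysis.
Set Implicit Arguments.
Unset Strict Implicit.
Unset Printing Implicit Defensive.
Import Order.TTheory GRing.Theory Num.Theory.
Import numFieldNormedType.Exports.
Local Open Scope classical_set_scope.
Local Open Scope ring_scope.

Definition log2 {R : realType} (x : R) : R := ln x / ln 2.

(* Extended version with log 0 = -oo, whereas [ln 0 = 0].  Since
   [`|-oo - y| = +oo] for all y, bounding a difference of two such logarithms
   by a real number forces both arguments to be positive. *)
Definition log2e {R : realType} (x : R) : \bar R :=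
  (lne x%:E * ((ln 2)^-1)%:E)%E.

Definition cylinders (B : finType) : set (set (nat -> B)) :=
  [set C | exists i b, C = [set s | s i = b]].

Definition seq_event (B : finType) : set (set (nat -> B)) :=
  <<s @cylinders B >>.

Definition shift_seq (B : finType) (s : nat -> B) : nat -> B := fun i => s i.+1.

Section Processes.
Context {R : realType} {d : measure_display} {T : measurableType d}.
Variable P : probability T R.

Definition Pr (E : set T) : R := fine (P E).

Section OneProcess.
Context {B : finType}.
Implicit Type W : nat -> T -> B.

(* The process W_1 W_2 ... is indexed from 0: [W i] is W_(i+1). *)
Definition process W := forall i b, measurable (W i @^-1` [set b]).

Definition trajectory W (w : T) : nat -> B := fun i => W i w.

(* [block W k t w] is W_(k+1) ... W_(k+t). *)
Definition block W (k t : nat) (w : T) : t.-tuple B :=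
  [tuple W (k + i)%N w | i < t].

Definition stationary W :=
  forall (k t : nat) (u : t.-tuple B),
    Pr [set w | block W k t w = u] = Pr [set w | block W 0 t w = u].

(* Ergodicity is not inherited by termwise sums: for independent ergodic X, Y
   with a common periodicity, (X, Y) and X + Y mod n need not be ergodic. *)
Definition ergodic W :=
  forall E : set (nat -> B), seq_event E -> @shift_seq B @^-1` E = E ->
    Pr (trajectory W @^-1` E) = 0 \/ Pr (trajectory W @^-1` E) = 1.

(* 0 log 0 = 0 holds here because [ln 0 = 0]. *)
Definition entropy_m W (m : nat) : R :=
  - (m.+1%:R)^-1 *
    \sum_(u : (m.+1).-tuple B)
      Pr [set w | block W 0 m.+1 w = u] *
      log2 (Pr [set w | block W 0 m.+1 w = u]).

Definition entropy W : R := limn (entropy_m W).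

End OneProcess.

Definition independent_processes {B C : finType}
    (X : nat -> T -> B) (Y : nat -> T -> C) :=
  forall (E : set (nat -> B)) (F : set (nat -> C)),
    seq_event E -> seq_event F ->
    Pr (trajectory X @^-1` E `&` trajectory Y @^-1` F) =
    Pr (trajectory X @^-1` E) * Pr (trajectory Y @^-1` F).

Definition joint {B C : finType} (X : nat -> T -> B) (Z : nat -> T -> C)
    : nat -> T -> (B * C)%type :=
  fun i w => (X i w, Z i w).

Definition cond_entropy_m {B C : finType}
    (X : nat -> T -> B) (Z : nat -> T -> C) (m : nat) : R :=
  entropy_m (joint X Z) m - entropy_m Z m.

Definition cond_entropy {B C : finType}
    (X : nat -> T -> B) (Z : nat -> T -> C) : R :=
  limn (cond_entropy_m X Z).

Definition cond_prob_set {B C : finType} (X : nat -> T -> B)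
    (Z : nat -> T -> C) (t : nat) (S : {set t.-tuple B}) (z : t.-tuple C) : R :=
  Pr ([set w | block X 0 t w \in S] `&` [set w | block Z 0 t w = z]) /
  Pr [set w | block Z 0 t w = z].

Definition cond_prob {B C : finType} (X : nat -> T -> B)
    (Z : nat -> T -> C) (t : nat) (x : t.-tuple B) (z : t.-tuple C) : R :=
  Pr ([set w | block X 0 t w = x] `&` [set w | block Z 0 t w = z]) /
  Pr [set w | block Z 0 t w = z].

End Processes.

Definition log_rate {R : realType} {B : finType}
    (t : nat) (S : {set t.-tuple B}) : \bar R :=
  ((t%:R^-1)%:E * log2e (#|S|%:R : R))%E.

(* Main.v *)
Require Import Defs.
From mathcomp Require Import all_boot all_order all_algebra.
From mathcomp Require Import all_classical all_reals all_analysis.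
From mathcomp Require Import ring lra.
Import Order.TTheory GRing.Theory Num.Theory.
Import numFieldNormedType.Exports.
Set Implicit Arguments.
Unset Strict Implicit.
Unset Printing Implicit Defensive.
Local Open Scope classical_set_scope.
Local Open Scope ring_scope.

(* With h = h(X) + h(Y) in nats, take for Psi_t(z) the set of x for which the
   joint probability P(x, z) = P(X = x) P(Y = z - x) lies within a factor
   exp(e t) of exp(- h t): in (ii) the factor P(z) cancels.  By the
   Shannon-McMillan-Breiman theorem for X and for Y, almost surely X_1 ... X_t
   eventually belongs to Psi_t(Z), and a Doob maximal inequality turns this into
   P(Psi_t(Z) | Z_1 ... Z_t) -> 1.  Since P(x, z) <= exp(- (h - e') t) on the
   smaller typical set with e' <= e, which has conditional probability at least
   1/2, |Psi_t(z)| >= P(z) exp((h - e') t) / 2 for every e'.  It remains to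
   bound P(z) from below: by n^-t up to exp(e' t) (Borel-Cantelli), or by
   Shannon-McMillan-Breiman for Z when Z is ergodic.

   The Shannon-McMillan-Breiman theorem is proved in the style of Ornstein and
   Weiss.  By a zero-one law, c = liminf - ln P(W_1 ... W_t) / t is constant.
   Hence most positions start a word of bounded length L and probability at
   least exp(- (c + e) L), and parsing greedily along such words gives a
   sub-probability q on words for which - ln q exceeds (c + e) t by at most a
   constant times the number of bad positions.  Comparing P with q through
   Gibbs' inequality bounds the entropy, and through Borel-Cantelli bounds the
   limsup, once the frequency of bad positions is controlled; the latter follows
   from the same greedy parsing. *)

(** * Probabilities of events and of words *)

Definition word {B : Type} (s : nat -> B) (k t : nat) : seq B :=
  [seq s i | i <- iota k t].

Lemma size_word {B : Type} (s : nat -> B) k t : size (word s k t) = t.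
Proof. by rewrite size_map size_iota. Qed.

Lemma wordD {B : Type} (s : nat -> B) k t1 t2 :
  word s k (t1 + t2) = word s k t1 ++ word s (k + t1) t2.
Proof. by rewrite /word iotaD map_cat. Qed.

Lemma word_shift (B : finType) (s : nat -> B) k t :
  word (shift_seq s) k t = word s k.+1 t.
Proof. by rewrite /word -add1n iotaDl -map_comp. Qed.

Lemma take_word {B : Type} (s : nat -> B) L k t :
  (L <= t)%N -> take L (word s k t) = word s k L.
Proof. by move=> Lt; rewrite -map_take take_iota (minn_idPl Lt). Qed.

Lemma tval_block {d} {T : measurableType d} {B : finType} (W : nat -> T -> B)
    k t w :
  block W k t w = word (trajectory W w) k t :> seq B.
Proof.
rewrite /= /word -[k in iota k t]addn0 iotaDl -map_comp -val_enum_ord -map_comp.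
exact: eq_map.
Qed.

Lemma block_eqE {d} {T : measurableType d} {B : finType} (W : nat -> T -> B)
    k t (u : t.-tuple B) :
  [set w | block W k t w = u] = [set w | word (trajectory W w) k t = u].
Proof.
apply/seteqP; split=> w /=; rewrite -tval_block; first by move=> ->.
exact: val_inj.
Qed.

Section Pr.
Context {R : realType} {d : measure_display} {T : measurableType d}.
Variable P : probability T R.
Implicit Types E F : set T.

Lemma PrK E : measurable E -> (Pr P E)%:E = P E.
Proof. by move=> mE; rewrite /Pr fineK// fin_num_measure. Qed.

Lemma Pr_ge0 E : 0 <= Pr P E.
Proof. exact: fine_ge0. Qed.

Lemma Pr_setT : Pr P setT = 1.
Proof. by rewrite /Pr probability_setT. Qed.

Lemma Pr_set0 : Pr P set0 = 0.
Proof. by rewrite /Pr measure0. Qed.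

Lemma le_Pr E F : measurable E -> measurable F -> E `<=` F -> Pr P E <= Pr P F.
Proof.
by move=> mE mF EF; rewrite -lee_fin !PrK// le_measure// inE.
Qed.

Lemma Pr_le1 E : measurable E -> Pr P E <= 1.
Proof. by move=> mE; rewrite -Pr_setT; exact: le_Pr. Qed.

Lemma PrC E : measurable E -> Pr P (~` E) = 1 - Pr P E.
Proof.
move=> mE; apply: EFin_inj; rewrite PrK; last exact: measurableC.
by rewrite probability_setC// EFinB PrK.
Qed.

Lemma PrU_le E F : measurable E -> measurable F ->
  Pr P (E `|` F) <= Pr P E + Pr P F.
Proof.
move=> mE mF; rewrite -lee_fin EFinD !PrK//; last exact: measurableU.
exact: measureU2.
Qed.

Lemma Pr_ae E F : measurable E -> measurable F ->
  {ae P, forall w, E w -> F w} -> Pr P E <= Pr P F.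
Proof.
move=> mE mF EF.
have N0 : P (E `\` F) = 0%E.
  apply/negligibleP; first exact: measurableD.
  by apply: negligibleS EF => w [Ew nFw] /(_ Ew).
rewrite -[leRHS]addr0 -(_ : Pr P (E `\` F) = 0); last by rewrite /Pr N0.
apply: le_trans (PrU_le _ _) => //; last exact: measurableD.
apply: le_Pr => //; first by apply: measurableU => //; exact: measurableD.
by move=> w Ew; have [|nF] := pselect (F w); [left|right].
Qed.

Lemma Pr1_ae E : measurable E -> Pr P E = 1 -> {ae P, forall w, E w}.
Proof.
move=> mE E1; apply/negligibleP; first exact: measurableC.
apply: etrans (esym (PrK (measurableC mE))) _.
by rewrite PrC// E1 subrr.
Qed.

Lemma Pr0_ae E : measurable E -> Pr P E = 0 -> {ae P, forall w, ~ E w}.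
Proof.
move=> mE E0; apply: Pr1_ae; first exact: measurableC.
by rewrite PrC// E0 subr0.
Qed.

Lemma Pr_lin (I : Type) (r : seq I) (a : I -> R) (A : I -> set T) :
  (forall i, measurable (A i)) ->
  P.-integrable setT (EFin \o (fun w => \sum_(i <- r) a i * \1_(A i) w)) /\
  \int[P]_w (\sum_(i <- r) a i * \1_(A i) w) = \sum_(i <- r) a i * Pr P (A i).
Proof.
move=> mA; elim: r => [|i r [intr IH]].
  split.
    apply: eq_integrable (finite_measure_integrable_cst P 0 measurableT) => //.
    by move=> w _; rewrite /= big_nil.
  under eq_Rintegral do rewrite big_nil.
  by rewrite Rintegral_cst// mul0r big_nil.
have inti : P.-integrable setT (EFin \o (fun w => a i * \1_(A i) w)).
  have := integrableZl measurableT (a i) (integrable_indic P (mA i)).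
  by apply: eq_integrable => // w _; rewrite /= EFinM.
split.
  have := integrableD measurableT inti intr.
  by apply: eq_integrable => // w _; rewrite /= big_cons EFinD.
under eq_Rintegral do rewrite big_cons.
rewrite RintegralD// IH big_cons; congr (_ + _).
rewrite RintegralZl//; last exact: integrable_indic.
by congr (_ * _); rewrite /Rintegral integral_indic// setIT.
Qed.

(** Integrate the pointwise inequality; [c] is unchanged because [P] has mass 1. This turns pathwise
    parsing bounds into bounds on probabilities. *)
Lemma Pr_lin_le (I J : Type) (r : seq I) (s : seq J) (a : I -> R) (b : J -> R)
    (A : I -> set T) (B : J -> set T) (c : R) :
  (forall i, measurable (A i)) -> (forall j, measurable (B j)) ->
  (forall w, \sum_(i <- r) a i * \1_(A i) w
             <= \sum_(j <- s) b j * \1_(B j) w + c) ->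
  \sum_(i <- r) a i * Pr P (A i) <= \sum_(j <- s) b j * Pr P (B j) + c.
Proof.
move=> mA mB AB.
have [iA <-] := Pr_lin r a mA; have [iB <-] := Pr_lin s b mB.
have ic := finite_measure_integrable_cst P c measurableT.
have -> : c = \int[P]_w c.
  by rewrite Rintegral_cst// -/(Pr P setT) Pr_setT mulr1.
rewrite -RintegralD//; apply: le_Rintegral => //.
by have := integrableD measurableT iB ic; apply: eq_integrable.
Qed.

Lemma ae_nondecreasing_Pr (A : nat -> set T) (e : R) :
  (forall n, measurable (A n)) -> nondecreasing_seq A -> 0 < e ->
  {ae P, forall w, exists n, A n w} -> exists n, 1 - e < Pr P (A n).
Proof.
move=> mA ndA e0 Aae.
have mU : measurable (\bigcup_n A n) by exact: bigcupT_measurable.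
have U1 : P (\bigcup_n A n) = 1%E.
  apply/eqP; rewrite eq_le probability_le1//= -[leLHS](probability_setT P).
  rewrite -!PrK// lee_fin; apply: Pr_ae => //.
  by apply: filterS Aae => w [n An] _; exists n.
have : P \o A @ \oo --> 1%:E by rewrite -U1; exact: nondecreasing_cvg_mu.
move=> /fine_cvgP[_].
move=> /cvgrPdist_lt/(_ e e0)[n _ /(_ n (leqnn n))]/= Hn.
exists n; move: Hn; rewrite -/(Pr P (A n)) ger0_norm ?subr_ge0 ?Pr_le1//.
by rewrite ltrBlDl -ltrBlDr.
Qed.

(** Monotonicity in [e] reduces the uncountable quantifier to the countable family [e = 1/(k+1)]. *)
Lemma ae_forall_inv (Q : R -> T -> Prop) :
  (forall e e' w, 0 < e -> e <= e' -> Q e w -> Q e' w) ->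
  (forall e, 0 < e -> {ae P, forall w, Q e w}) ->
  {ae P, forall w, forall e, 0 < e -> Q e w}.
Proof.
move=> Qmono Qae.
have : {ae P, forall w, forall k : nat, Q (k.+1%:R^-1) w}.
  by apply: ae_foralln => k; apply: Qae; rewrite invr_gt0.
apply: filterS => w Qw e e0.
have [k ke] : exists k : nat, k.+1%:R^-1 <= e.
  exists (Num.truncn e^-1); rewrite -[leRHS]invrK lef_pV2 ?posrE ?invr_gt0//.
  by rewrite ltW// truncnS_gt.
by apply: Qmono (Qw k) => //; rewrite invr_gt0.
Qed.

End Pr.

Section Words.
Context {R : realType} {d : measure_display} {T : measurableType d}.
Variable P : probability T R.
Context {B : finType}.
Variable W : nat -> T -> B.
Hypothesis mW : process W.

Lemma measurable_word_eq k t u :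
  measurable [set w | word (trajectory W w) k t = u].
Proof.
elim: t k u => [|t IH] k [|b u].
- by rewrite [X in measurable X](_ : _ = setT)//; apply/seteqP; split.
- by rewrite [X in measurable X](_ : _ = set0)//; apply/seteqP; split.
- by rewrite [X in measurable X](_ : _ = set0)//; apply/seteqP; split.
rewrite [X in measurable X](_ : _ =
  W k @^-1` [set b] `&` [set w | word (trajectory W w) k.+1 t = u]).
  by apply: measurableI => //; exact: mW.
by apply/seteqP; split=> w /= [<- <-].
Qed.

Lemma measurable_word (Q : seq B -> Prop) k t :
  measurable [set w | Q (word (trajectory W w) k t)].
Proof.
rewrite [X in measurable X](_ : _ =
  \bigcup_(u in [set u : t.-tuple B | Q u])
     [set w | word (trajectory W w) k t = u]).
  by apply: fin_bigcup_measurable => // u _; exact: measurable_word_eq.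
apply/seteqP; split=> [w Qw|w [u Qu /= ->]//].
have sz : size (word (trajectory W w) k t) == t by rewrite size_word.
by exists (Tuple sz).
Qed.

End Words.

(** * Greedy parsing and block codes *)

Lemma sum_tuple_cat {R : nmodType} {B : finType} m n (F : seq B -> seq B -> R) :
  \sum_(u : (m + n).-tuple B) F (take m u) (drop m u) =
  \sum_(u : m.-tuple B) \sum_(v : n.-tuple B) F u v.
Proof.
rewrite pair_big /=.
rewrite (reindex (fun uv : m.-tuple B * n.-tuple B => cat_tuple uv.1 uv.2)) /=.
  apply: eq_bigr => -[u v] _ /=.
  by rewrite take_size_cat ?size_tuple// drop_size_cat ?size_tuple.
apply: onW_bij; apply: inj_card_bij.
  move=> [u v] [u' v'] /= /(congr1 val)/= /eqP.
  by rewrite eqseq_cat ?size_tuple// => /andP[/eqP/val_inj-> /eqP/val_inj->].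
by rewrite card_prod !card_tuple expnD.
Qed.

Section Code.
Context {R : realType} {B : finType}.
Variables (alpha : R) (beta : nat -> R) (p : seq B -> R).
Hypothesis alpha0 : 0 <= alpha.
Hypothesis beta0 : forall L, 0 <= beta L.
Hypothesis p0 : forall u, 0 <= p u.

(* A random word of a given length is cut into a first block, either one letter
   (weight [alpha] each) or a word of length [L] drawn with law [p] (weight
   [beta L]), and a rest treated recursively; [k] is fuel, [size u] suffices. *)
Fixpoint block_code (k : nat) (u : seq B) : R :=
  if u is _ :: u' then
    if k is k'.+1 then
      alpha * block_code k' u' +
      \sum_(1 <= L < (size u).+1)
        beta L * p (take L u) * block_code k' (drop L u)
    else 0
  else 1.

Lemma block_code_ge0 k u : 0 <= block_code k u.
Proof.
elim: k u => [|k IH] [|b u]//=; rewrite addr_ge0 ?mulr_ge0 ?sumr_ge0// => L _.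
by rewrite !mulr_ge0.
Qed.

(** After a block of length [L] the fuel left is [size u - 1], at least the [size u - L] that the
    rest requires; monotonicity bridges the gap. *)
Lemma block_code_nondecreasing u :
  {homo block_code^~ u : k l / (k <= l)%N >-> k <= l}.
Proof.
apply: homo_leq; [exact: lexx|exact: le_trans|move=> k].
elim: k u => [|k IH] [|b u]//; first exact: (block_code_ge0 1 (b :: u)).
apply: lerD; first by rewrite ler_wpM2l.
by apply: ler_sum => L _; rewrite ler_wpM2l// mulr_ge0.
Qed.

Lemma block_code_single b u :
  alpha * block_code (size u) u <= block_code (size u).+1 (b :: u).
Proof.
by rewrite /= lerDl sumr_ge0// => L _; rewrite !mulr_ge0// block_code_ge0.
Qed.

Lemma block_code_block L u : (0 < L <= size u)%N ->
  beta L * p (take L u) * block_code (size u - L) (drop L u)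
  <= block_code (size u) u.
Proof.
case: L => // L; case: u => // b u Lu.
rewrite [leRHS]/= ler_wpDl ?mulr_ge0 ?block_code_ge0//.
rewrite (bigD1_seq L.+1) ?iota_uniq//=; last first.
  by rewrite mem_index_iota ltnS.
rewrite ler_wpDr ?sumr_ge0// => [i _|].
  by rewrite !mulr_ge0 ?block_code_ge0.
rewrite ler_wpM2l ?mulr_ge0//; apply: block_code_nondecreasing.
by rewrite subSS leq_subr.
Qed.

Lemma block_code_gt0 u : 0 < alpha -> 0 < block_code (size u) u.
Proof.
move=> a0; elim: u => [|b u IH]; first exact: ltr01.
by apply: lt_le_trans (block_code_single b u); rewrite mulr_gt0.
Qed.

Hypothesis p1 : forall L, \sum_(u : L.-tuple B) p u <= 1.
Hypothesis weights1 : forall N, alpha * #|B|%:R + \sum_(1 <= L < N) beta L <= 1.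

(** Induction on the fuel: splitting off the first block makes each sum factor, and the rest has
    mass at most 1, which leaves the total of the weights. *)
Lemma sum_block_code k t : \sum_(u : t.-tuple B) block_code k u <= 1.
Proof.
elim: k t => [|k IH] [|t].
- by rewrite (big_pred1 [tuple]) => [|u]; [|rewrite [u]tuple0 /= eqxx].
- by rewrite big1 => [|u _]; [exact: ler01|case/tupleP: u].
- by rewrite (big_pred1 [tuple]) => [|u]; [|rewrite [u]tuple0 /= eqxx].
pose H L (u v : seq B) := beta L * p u * block_code k v.
rewrite (eq_bigr (fun u : t.+1.-tuple B => alpha * block_code k (drop 1 u) +
    \sum_(1 <= L < t.+2) H L (take L u) (drop L u))); last first.
  by case/tupleP => b u _ /=; rewrite drop0 size_tuple.
rewrite big_split/= exchange_big/=; apply: le_trans (weights1 t.+2).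
apply: lerD.
  rewrite -mulr_sumr ler_wpM2l//.
  have := @sum_tuple_cat R B 1 t (fun _ v => block_code k v).
  rewrite add1n => ->.
  by rewrite sumr_const card_tuple expn1 ler_wMn2r.
rewrite big_nat [leRHS]big_nat; apply: ler_sum => L /andP[L0 Lt].
have -> : t.+1 = (L + (t.+1 - L))%N by rewrite subnKC.
rewrite sum_tuple_cat /H.
under eq_bigr do rewrite -mulr_sumr.
rewrite -mulr_suml -mulr_sumr -[leRHS]mulr1 ler_pM ?mulr_ge0 ?sumr_ge0//.
- by move=> u _; exact: block_code_ge0.
- by rewrite ler_piMr.
Qed.

End Code.

(* Parse greedily from the left: a good position starts a block of length at
   most [M] and cost at most [a] per letter, every other position is a single
   letter at extra cost [K]; at most [M] letters are left over at the end. *)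
Lemma greedy_parse {R : realType} (a K : R) (M : nat) (good : pred nat)
    (cost : nat -> nat -> R) :
  0 <= K -> (forall k, cost k 0 <= 0) ->
  (forall k N, cost k N.+1 <= a + K + cost k.+1 N) ->
  (forall k, good k -> exists2 L, (0 < L <= M)%N &
     forall N, cost k (L + N)%N <= a * L%:R + cost (k + L)%N N) ->
  forall k N,
    cost k N <= a * N%:R + K * (\sum_(k <= i < k + N) (~~ good i)%:R + M%:R).
Proof.
move=> K0 c0 c1 cgood k N.
have bad0 l m : 0 <= \sum_(l <= i < m) (~~ good i)%:R :> R by exact: sumr_ge0.
(* Crude bound treating every letter as bad; it serves for the last [M] letters, where a block could
   overrun the end. *)
have short l m : cost l m <= (a + K) * m%:R.
  elim: m l => [|m IH] l; first by rewrite mulr0.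
  by apply: le_trans (c1 _ _) _; rewrite -natr1 mulrDr mulr1 addrC lerD2r.
have [n] := ubnP N; elim: n => // n IH in k N *; rewrite ltnS => Nn.
have [NM|MN] := leqP N M.
  apply: le_trans (short _ _) _; rewrite mulrDl lerD2l ler_wpM2l//.
  by rewrite ler_wpDl// ler_nat.
have [gk|bk] := boolP (good k).
  have [L /andP[L0 LM] HL] := cgood _ gk.
  have LN : (L <= N)%N by rewrite (leq_trans LM)// ltnW.
  rewrite -{1}(subnKC LN); apply: le_trans (HL _) _.
  apply: le_trans (lerD (lexx _) (IH _ _ _)) _.
    by apply: leq_trans Nn; rewrite ltn_subrL L0 (leq_ltn_trans _ MN).
  rewrite addrA -mulrDr -natrD subnKC// lerD2l ler_wpM2l// lerD2r.
  rewrite -addnA subnKC// [leRHS](@big_cat_nat _ _ _ (k + L)) ?leq_addr//=.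
    by rewrite ler_wpDl.
  by rewrite leq_add2l.
case: N => // N in Nn MN *; apply: le_trans (c1 _ _) _.
apply: le_trans (lerD (lexx _) (IH _ _ Nn)) _.
rewrite addSnnS [leRHS](_ : _ = a * N.+1%:R + K *
  ((~~ good k)%:R + \sum_(k.+1 <= i < k + N.+1) (~~ good i)%:R + M%:R)).
  rewrite bk -(natr1 N) /=; set X := \sum_(_ <= _ < _) _.
  by rewrite le_eqVlt; apply/orP; left; apply/eqP; ring.
by rewrite [in LHS]big_ltn // addnS ltnS leq_addr.
Qed.

(** This is [ln x <= x - 1] at [x = q i / p i], multiplied by [p i] and summed; indices with
    [p i = 0] are treated apart. *)
Lemma gibbs {R : realType} (I : finType) (p q : I -> R) :
  (forall i, 0 <= p i) -> (forall i, 0 < q i) ->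
  \sum_i q i <= \sum_i p i ->
  \sum_i p i * - ln (p i) <= \sum_i p i * - ln (q i).
Proof.
move=> p0 q0 qp; rewrite -subr_ge0 -sumrB.
suff : \sum_i (p i - q i) <= \sum_i (p i * - ln (q i) - p i * - ln (p i)).
  by apply: le_trans; rewrite sumrB subr_ge0.
apply: ler_sum => i _; rewrite -mulrBr opprK [- _ + _]addrC.
have := p0 i; rewrite le_eqVlt => /predU1P[<-|pi0].
  by rewrite mul0r sub0r oppr_le0 ltW.
have -> : ln (p i) - ln (q i) = - ln (q i / p i).
  by rewrite ln_div ?posrE// opprB.
rewrite mulrN -lerN2 opprK opprB.
have -> : q i - p i = p i * (q i / p i - 1).
  by rewrite mulrBr mulr1 mulrC divfK ?gt_eqF.
apply: ler_wpM2l; first exact: ltW.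
have /(@le_ln1Dx R) : -1 < q i / p i - 1 by rewrite ltrBrDl subrr divr_gt0.
by rewrite addrC subrK.
Qed.

(** * Laws of words and stationarity *)

Lemma indic_bool {R : realType} {T : Type} (Q : T -> bool) w :
  \1_[set w | Q w] w = (Q w)%:R :> R.
Proof.
rewrite indicE; case: (boolP (Q w)) => h; first by rewrite mem_set.
by rewrite memNset//; exact/negP.
Qed.

Section Law.
Context {R : realType} {d : measure_display} {T : measurableType d}.
Variable P : probability T R.
Context {B : finType}.
Implicit Type W : nat -> T -> B.

Definition law W (u : seq B) : R :=
  Pr P [set w | word (trajectory W w) 0 (size u) = u].

Lemma law_ge0 W u : 0 <= law W u. Proof. exact: Pr_ge0. Qed.

Lemma sum_indic_word W (F : seq B -> R) k t w :
  \sum_(u : t.-tuple B) F u * \1_[set w | word (trajectory W w) k t = u] w =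
  F (word (trajectory W w) k t).
Proof.
have sz : size (word (trajectory W w) k t) == t by rewrite size_word.
rewrite (bigD1 (Tuple sz))//= indicE mem_set// mulr1 big1 ?addr0// => u.
move=> uw; rewrite indicE memNset ?mulr0//= => wu.
by move/eqP: uw; apply; apply: val_inj.
Qed.

Section OneProcess.
Variable W : nat -> T -> B.
Hypothesis mW : process W.
Local Notation X w := (trajectory W w).

Lemma Pr_word_law t (u : t.-tuple B) :
  Pr P [set w | word (X w) 0 t = u] = law W u.
Proof. by rewrite /law size_tuple. Qed.

Lemma Pr_wordI (C : set T) (Q : pred (seq B)) k t : measurable C ->
  Pr P (C `&` [set w | Q (word (X w) k t)]) =
  \sum_(u : t.-tuple B | Q u) Pr P (C `&` [set w | word (X w) k t = u]).
Proof.
move=> mC.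
have mQ (i : unit) : measurable (C `&` [set w | Q (word (X w) k t)]).
  by apply: measurableI => //; exact: (measurable_word mW Q k t).
have mu (u : t.-tuple B) : measurable (C `&` [set w | word (X w) k t = u]).
  by apply: measurableI => //; exact: measurable_word_eq.
have [_ H1] := Pr_lin P [:: tt] (fun=> 1) mQ.
have [_ H2] := Pr_lin P (index_enum _) (fun u : t.-tuple B => (Q u)%:R) mu.
rewrite big_seq1 mul1r in H1; rewrite -H1 big_mkcond/=.
transitivity (\sum_(u : t.-tuple B)
    (Q u)%:R * Pr P (C `&` [set w | word (X w) k t = u])).
  rewrite -H2; apply: eq_Rintegral => w _.
  under [RHS]eq_bigr do rewrite indicI /= mulrCA.
  have /= H := sum_indic_word W (fun u => (Q u)%:R) k t w.
  rewrite -[RHS]mulr_sumr H big_seq1 mul1r.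
  by rewrite indicI /= indic_bool.
by apply: eq_bigr => u _; case: (Q _); rewrite ?mul1r ?mul0r.
Qed.

Lemma Pr_word (Q : pred (seq B)) k t :
  Pr P [set w | Q (word (X w) k t)] =
  \sum_(u : t.-tuple B | Q u) Pr P [set w | word (X w) k t = u].
Proof.
rewrite -(setTI [set w | _]) Pr_wordI//.
by apply: eq_bigr => u _; rewrite setTI.
Qed.

Lemma sum_law t : \sum_(u : t.-tuple B) law W u = 1.
Proof.
rewrite -(Pr_setT P) [in RHS](_ : setT = [set w | xpredT (word (X w) 0 t)]).
  rewrite (Pr_word xpredT 0 t).
  by apply: eq_bigr => u _; rewrite Pr_word_law.
by apply/seteqP; split.
Qed.

(* Borel-Cantelli: at time [t] the inequality fails with probability at most
   [expR (- (e * t))]. *)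
Lemma law_ge_subprobability (q : nat -> seq B -> R) (e : R) :
  (forall t u, 0 <= q t u) -> (forall t, \sum_(u : t.-tuple B) q t u <= 1) ->
  0 < e ->
  {ae P, forall w, exists N, forall t, (N <= t)%N ->
     expR (- (e * t%:R)) * q t (word (X w) 0 t) <= law W (word (X w) 0 t)}.
Proof.
move=> q0 q1 e0.
pose Q t u := law W u < expR (- (e * t%:R)) * q t u.
pose A t := [set w | Q t (word (X w) 0 t)].
have mA t : measurable (A t) by exact: (measurable_word mW (Q t) 0 t).
have PA t : (P (A t) <= (geometric 1 (expR (- e)) t)%:E)%E.
  rewrite -PrK// lee_fin Pr_word.
  apply: (@le_trans _ _ (\sum_(u : t.-tuple B) expR (- (e * t%:R)) * q t u)).
    rewrite [leRHS](bigID (fun u : t.-tuple B => Q t u))/=.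
    rewrite ler_wpDr ?sumr_ge0// => [u _|]; first by rewrite mulr_ge0// expR_ge0.
    by apply: ler_sum => u /ltW; rewrite Pr_word_law.
  rewrite -mulr_sumr /= mul1r -expRM_natr -mulNr.
  by apply: ler_piMr; [exact: expR_ge0|exact: q1].
have /(lim_sup_set_cvg0 mA) A0 : (\sum_(n <oo) P (A n) < +oo)%E.
  have r1 : expR (- e) < 1 by rewrite expR_lt1 oppr_lt0.
  apply: (@le_lt_trans _ _ (1 - expR (- e))^-1%:E); last exact: ltry.
  apply: lime_le; first exact: is_cvg_nneseries.
  apply: nearW => n; apply: le_trans (lee_sum _ (fun i _ => PA i)) _.
  rewrite sumEFin lee_fin -[leLHS]/(series (geometric 1 (expR (- e))) n).
  rewrite geometric_seriesE ?lt_eqF//= mul1r ler_piMl ?invr_ge0 ?subr_ge0 ?ltW//.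
  by rewrite ltrBlDr ltrDl exprn_gt0 ?expR_gt0.
have : {ae P, forall w, ~ lim_sup_set A w}.
  apply: Pr0_ae; last by rewrite /Pr A0.
  by apply: bigcap_measurable => // n _; exact: bigcup_measurable.
apply: filterS => w /existsNP[N] /not_implyP[_ HN]; exists N => t Nt.
by rewrite leNgt; apply: contra_notN HN => Qt; exists t.
Qed.

(** For each [t] there are finitely many words of law 0, and each occurs with probability 0.
    Divisions by the law of the ciphertext rely on this. *)
Lemma law_gt0_ae :
  {ae P, forall w, forall t, 0 < law W (word (X w) 0 t)}.
Proof.
apply: ae_foralln => t.
pose Q u := law W u <= 0.
have mQ : measurable [set w | Q (word (X w) 0 t)].
  exact: (measurable_word mW Q 0 t).
apply: filterS (Pr0_ae mQ _) => [w|]; first by move/negP; rewrite -ltNge.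
rewrite Pr_word big1// => u; rewrite Pr_word_law => Qu.
by apply/eqP; rewrite eq_le law_ge0 andbT.
Qed.

Section Stationary.
Hypothesis sW : stationary P W.

Lemma Pr_word_shift (Q : pred (seq B)) k t :
  Pr P [set w | Q (word (X w) k t)] = Pr P [set w | Q (word (X w) 0 t)].
Proof.
rewrite !Pr_word; apply: eq_bigr => u _.
by rewrite -!block_eqE sW.
Qed.

(** An occurrence of [b :: u] at position 0 forces [u] at position 1, which by stationarity has
    probability [law W u]. *)
Lemma law_behead b u : law W (b :: u) <= law W u.
Proof.
have H := Pr_word_shift (pred1 u) 1 (size u).
have E j : [set w | pred1 u (word (X w) j (size u))] =
           [set w | word (X w) j (size u) = u].
  by apply/seteqP; split=> w /= /eqP.
rewrite !E in H; rewrite /law -H.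
apply: le_Pr; [exact: measurable_word_eq..|].
by move=> w /= [].
Qed.

Lemma measurable_trajectory (E : set (nat -> B)) :
  seq_event E -> measurable (trajectory W @^-1` E).
Proof.
move=> /(_ [set E | measurable (trajectory W @^-1` E)]); apply; split.
  split=> [|A mA|F mF] /=.
  - by rewrite preimage_set0.
  - by rewrite setTD preimage_setC; exact: measurableC.
  - by rewrite preimage_bigcup; exact: bigcupT_measurable.
by move=> _ [i [b ->]]; exact: mW.
Qed.

(** A pi-system whose sigma-algebra contains [seq_event]: events on finite prefixes are closed under
    intersection, which single-letter cylinders are not in general. *)
Definition block_events : set (set (nat -> B)) :=
  [set E | exists t (Q : pred (seq B)), E = [set s | Q (word s 0 t)]].

Lemma seq_event_blocks : @seq_event B `<=` <<s block_events >>.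
Proof.
apply: smallest_sub; first exact: smallest_sigma_algebra.
move=> _ [i [b ->]]; apply: sub_sigma_algebra.
exists i.+1, (fun u => nth b u i == b); apply/seteqP; split=> s /=;
  rewrite (nth_map 0%N) ?size_iota// nth_iota// add0n; first by move=> ->.
by move/eqP.
Qed.

(** Dynkin's argument: the sets with the claimed properties form a lambda-system, and stationarity
    puts the pi-system [block_events] inside it. *)
Lemma shift_invariant (E : set (nat -> B)) : seq_event E ->
  measurable (trajectory W @^-1` (@shift_seq B @^-1` E)) /\
  P (trajectory W @^-1` (@shift_seq B @^-1` E)) = P (trajectory W @^-1` E).
Proof.
pose tr := trajectory W; pose sh := @shift_seq B.
pose H := [set E : set (nat -> B) | [/\ measurable (tr @^-1` E),
  measurable (tr @^-1` (sh @^-1` E)) &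
  P (tr @^-1` (sh @^-1` E)) = P (tr @^-1` E)]].
suff sub : @seq_event B `<=` H by move/sub => [].
apply: subset_trans seq_event_blocks _; apply: lambda_system_subset => //.
- move=> _ _ [t [Q ->]] [t' [Q' ->]].
  exists (maxn t t'), (fun u => Q (take t u) && Q' (take t' u)).
  apply/seteqP; split=> s /=; rewrite !take_word ?leq_maxl ?leq_maxr//.
    by move=> [-> ->].
  by move=> /andP[].
- split=> //.
  + by split; rewrite ?preimage_setT.
  + move=> {}E F FE [mE msE PE] [mF msF PF].
    have fin A : measurable A -> (P A < +oo)%E.
      by move=> mA; rewrite (le_lt_trans (probability_le1 P mA))// ltry.
    split; rewrite ?preimage_setD; [exact: measurableD..|].
    rewrite !measureD ?fin//.
    rewrite (_ : _ `&` _ = tr @^-1` (sh @^-1` F)); last first.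
      by apply/seteqP; split=> w => [[]|Fw] //; split=> //; exact: FE Fw.
    rewrite (_ : tr @^-1` E `&` _ = tr @^-1` F); last first.
      by apply/seteqP; split=> w => [[]|Fw] //; split=> //; exact: FE Fw.
    by congr (_ - _)%E; [exact: PE|exact: PF].
  + move=> F ndF HF.
    have m1 n : measurable (tr @^-1` (F n)) by have [] := HF n.
    have m2 n : measurable (tr @^-1` (sh @^-1` (F n))) by have [] := HF n.
    have nd1 : nondecreasing_seq (fun n => tr @^-1` (F n)).
      move=> m n mn; apply/subsetPset => w; rewrite /preimage /=.
      by move/ndF: mn => /subsetPset; apply.
    have nd2 : nondecreasing_seq (fun n => tr @^-1` (sh @^-1` (F n))).
      move=> m n mn; apply/subsetPset => w; rewrite /preimage /=.
      by move/ndF: mn => /subsetPset; apply.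
    split; rewrite !preimage_bigcup; [exact: bigcupT_measurable..|].
    have /cvg_lim <- // :=
      nondecreasing_cvg_mu (mu := P) m1 (bigcupT_measurable _ m1) nd1.
    have /cvg_lim <- // :=
      nondecreasing_cvg_mu (mu := P) m2 (bigcupT_measurable _ m2) nd2.
    by apply/congr_lim/funext => n /=; have [] := HF n.
- move=> _ [t [Q ->]]; split.
  + exact: (measurable_word mW Q 0 t).
  + have := measurable_word mW Q 1 t.
    by congr measurable; apply/seteqP; split=> w; rewrite /= word_shift.
  + have := congr1 EFin (Pr_word_shift Q 1 t).
    rewrite (PrK P (measurable_word mW Q 1 t)).
    rewrite (PrK P (measurable_word mW Q 0 t)).
    by move=> <-; congr (P _); apply/seteqP; split=> w; rewrite /= word_shift.
Qed.

End Stationary.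
End OneProcess.
End Law.

(** * The zero-one law *)

Section SeqEvents.
Context {B : finType}.
Implicit Types E F : set (nat -> B).

Lemma seq_event0 : seq_event (@set0 (nat -> B)).
Proof. by have [] := @smallest_sigma_algebra _ setT (@cylinders B). Qed.

Lemma seq_eventC E : seq_event E -> seq_event (~` E).
Proof.
by have [_ + _] := @smallest_sigma_algebra _ setT (@cylinders B);
  rewrite -setTD; apply.
Qed.

Lemma seq_event_bigcup (F : nat -> set (nat -> B)) :
  (forall n, seq_event (F n)) -> seq_event (\bigcup_n F n).
Proof.
by have [_ _] := @smallest_sigma_algebra _ setT (@cylinders B); apply.
Qed.

Lemma seq_event_bigcap (F : nat -> set (nat -> B)) :
  (forall n, seq_event (F n)) -> seq_event (\bigcap_n F n).
Proof.
move=> sF; rewrite -[X in seq_event X]setCK setC_bigcap.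
apply: seq_eventC; apply: seq_event_bigcup => n.
by apply: seq_eventC; exact: sF.
Qed.

Lemma seq_eventI E F : seq_event E -> seq_event F -> seq_event (E `&` F).
Proof.
move=> sE sF; rewrite (_ : _ `&` _ = \bigcap_n (if n is 0 then E else F)).
  by apply: seq_event_bigcap => -[].
apply/seteqP; split=> [s [Es Fs] [|n] _ //|s EF].
by split; [exact: (EF 0%N)|exact: (EF 1%N)].
Qed.

Lemma seq_event_word (Q : seq B -> Prop) k t :
  seq_event [set s | Q (word s k t)].
Proof.
have word_eq u : seq_event [set s : nat -> B | word s k t = u].
  elim: t k u => [|t IH] k [|b u].
  - rewrite [X in seq_event X](_ : _ = ~` set0).
      by apply: seq_eventC; exact: seq_event0.
    by apply/seteqP; split=> // s _ [].
  - rewrite [X in seq_event X](_ : _ = set0); first exact: seq_event0.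
    by apply/seteqP; split.
  - rewrite [X in seq_event X](_ : _ = set0); first exact: seq_event0.
    by apply/seteqP; split.
  rewrite [X in seq_event X](_ : _ =
    [set s | s k = b] `&` [set s | word s k.+1 t = u]).
    by apply: seq_eventI => //; apply: sub_sigma_algebra; exists k, b.
  by apply/seteqP; split=> w /= [<- <-].
(* Words over [B] are countable; enumerating them by [unpickle] writes the event as a countable
   union, even for undecidable [Q]. *)
pose F n := if unpickle n is Some u then
  if pselect (Q u) then [set s : nat -> B | word s k t = u] else set0 else set0.
rewrite [X in seq_event X](_ : _ = \bigcup_n F n).
  apply: seq_event_bigcup => n; rewrite /F.
  case: unpickle => [u|]; last exact: seq_event0.
  by case: pselect => Qu /=; [exact: word_eq|exact: seq_event0].
apply/seteqP; split=> [s Qs|s [n _]]; rewrite /F.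
  by exists (pickle (word s k t)) => //; rewrite pickleK; case: pselect.
by case: unpickle => // u; case: pselect => //= Qu ->.
Qed.

Lemma seq_event_shift E : seq_event E -> seq_event (@shift_seq B @^-1` E).
Proof.
move=> /(_ [set E | seq_event (@shift_seq B @^-1` E)]); apply; split.
  split=> [|A mA|F mF] /=.
  - by rewrite preimage_set0; exact: seq_event0.
  - by rewrite setTD preimage_setC; exact: seq_eventC.
  - by rewrite preimage_bigcup; exact: seq_event_bigcup.
move=> _ [i [b ->]]; apply: sub_sigma_algebra.
by exists i.+1, b.
Qed.

End SeqEvents.

Section ZeroOne.
Context {R : realType} {d : measure_display} {T : measurableType d}.
Variable P : probability T R.
Context {B : finType}.
Variable W : nat -> T -> B.
Hypothesis mW : process W.
Hypothesis sW : stationary P W.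
Hypothesis eW : ergodic P W.
Local Notation tr := (trajectory W).

(** The iterated preimages of [E] under the shift increase and all have the probability of [E]. So
    does their union, which is exactly invariant, so that ergodicity applies to it. *)
Lemma zero_one (E : set (nat -> B)) : seq_event E ->
  E `<=` @shift_seq B @^-1` E ->
  Pr P (tr @^-1` E) = 0 \/ Pr P (tr @^-1` E) = 1.
Proof.
move=> sE subE.
pose F k := iter k (fun A : set (nat -> B) => @shift_seq B @^-1` A) E.
have FS k : F k.+1 = @shift_seq B @^-1` (F k) by [].
have sF k : seq_event (F k) by elim: k => // k IH; exact: seq_event_shift.
have PF k : P (tr @^-1` (F k)) = P (tr @^-1` E).
  by elim: k => // k <-; have [_] := shift_invariant mW sW (sF k).
have subF k : F k `<=` F k.+1.
  elim: k => // k IH s; rewrite FS => /IH; exact.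
have ndF : nondecreasing_seq F.
  by apply/nondecreasing_seqP => k; apply/subsetPset; exact: subF.
have ndtF : nondecreasing_seq (fun k => tr @^-1` (F k)).
  move=> m n mn; apply/subsetPset => w; rewrite /preimage /=.
  by move/ndF: mn => /subsetPset; apply.
have mtF k : measurable (tr @^-1` (F k)) by exact: measurable_trajectory.
have PU : P (\bigcup_k (tr @^-1` (F k))) = P (tr @^-1` E).
  have /cvg_lim <- // :=
    nondecreasing_cvg_mu (mu := P) mtF (bigcupT_measurable _ mtF) ndtF.
  by apply: lim_near_cst => //; apply: nearW => k /=; exact: PF.
have <- : Pr P (tr @^-1` (\bigcup_k F k)) = Pr P (tr @^-1` E).
  by rewrite /Pr preimage_bigcup PU.
apply: eW; first exact: seq_event_bigcup.
apply/seteqP; split=> s [k _].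
  by exists k.+1.
by exists k => //; exact: subF.
Qed.

(* When [V b t] weakens as [b] grows, replacing [a] by [a + 1/(k+1)] makes the
   event stable under the shift despite the loss of one letter. *)
Definition io (V : R -> nat -> set (nat -> B)) (a : R) : set (nat -> B) :=
  [set s | forall k N : nat, exists2 t, (N <= t)%N & V (a + k.+1%:R^-1) t s].

Lemma seq_event_io (V : R -> nat -> set (nat -> B)) (a : R) :
  (forall b t, seq_event (V b t)) -> seq_event (io V a).
Proof.
move=> sV; rewrite [X in seq_event X](_ : _ = \bigcap_k \bigcap_N \bigcup_t
    (if (N <= t)%N then V (a + k.+1%:R^-1) t else set0)).
  apply: seq_event_bigcap => k; apply: seq_event_bigcap => N.
  apply: seq_event_bigcup => t; case: ifP => _; [exact: sV|exact: seq_event0].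
apply/seteqP; split=> s H.
  by move=> k _ N _; have [t Nt Vt] := H k N; exists t => //; rewrite Nt.
by move=> k N; have [t _] := H k Logic.I N Logic.I; case: ifP => // Nt; exists t.
Qed.

Lemma io_zero_one (V : R -> nat -> set (nat -> B)) (a : R) :
  (forall b t, seq_event (V b t)) ->
  (forall b c, b < c -> exists N : nat, forall t s, (N <= t)%N ->
     V b t.+1 s -> V c t (shift_seq s)) ->
  Pr P (tr @^-1` (io V a)) = 0 \/ Pr P (tr @^-1` (io V a)) = 1.
Proof.
move=> sV Vsh; apply: zero_one; first exact: seq_event_io.
move=> s H k N.
(* The gap between the thresholds at [k.+1] and at [k] pays for the deleted letter. *)
have [|N0 HN0] := Vsh (a + k.+2%:R^-1) (a + k.+1%:R^-1).
  by rewrite ltrD2l ltf_pV2 ?posrE// ltr_nat.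
have [[|t]] := H k.+1 (maxn N N0).+1; first by rewrite ltn0.
rewrite ltnS geq_max => /andP[Nt N0t] Vt.
by exists t => //; exact: HN0.
Qed.

End ZeroOne.

(** * The entropy rate *)

Lemma exists_nat_ge {R : realType} (x : R) : exists N : nat, x <= N%:R.
Proof. by exists (Num.truncn x).+1; rewrite ltW// truncnS_gt. Qed.

Lemma exists_natV_lt {R : realType} (x : R) : 0 < x ->
  exists k : nat, k.+1%:R^-1 < x.
Proof.
move=> x0; exists (Num.truncn x^-1).
by rewrite -[ltRHS]invrK ltf_pV2 ?posrE ?invr_gt0// truncnS_gt.
Qed.

Section Rate.
Context {R : realType} {d : measure_display} {T : measurableType d}.
Variable P : probability T R.
Context {B : finType}.
Variable W : nat -> T -> B.
Hypothesis mW : process W.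
Hypothesis sW : stationary P W.
Hypothesis eW : ergodic P W.
Local Notation tr := (trajectory W).
Local Notation law := (law P W).

Lemma law_le1 u : law u <= 1.
Proof. by apply: Pr_le1; exact: measurable_word_eq. Qed.

Lemma card_letters_gt0 : (0 < #|B|)%N.
Proof. by apply/card_gt0P; exists (W 0 point). Qed.

Let V (a : R) (t : nat) : set (nat -> B) :=
  [set s | expR (- (a * t%:R)) < law (word s 0 t)].

Let sV a t : seq_event (V a t).
Proof. exact: (seq_event_word (fun u => expR (- (a * t%:R)) < law u) 0 t). Qed.

Let V_io_01 a : Pr P (tr @^-1` (io V a)) = 0 \/ Pr P (tr @^-1` (io V a)) = 1.
Proof.
apply: io_zero_one => // b c bc.
(* For [t >= b / (c - b)] one has [b * (t + 1) <= c * t], so the lost letter fits in the change of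
   rate. *)
have [N HN] := exists_nat_ge (b / (c - b)).
exists N => t s Nt; rewrite /V /= => Vt.
rewrite word_shift; apply: lt_le_trans (law_behead mW sW (s 0%N) (word s 1 t)).
apply: le_lt_trans Vt; rewrite ler_expR lerN2 -natr1 mulrDr mulr1.
rewrite -lerBrDl -mulrBl -ler_pdivrMl ?subr_gt0// mulrC.
by apply: le_trans HN _; rewrite ler_nat.
Qed.

Let mV a : measurable (tr @^-1` (io V a)).
Proof. by apply: measurable_trajectory => //; exact: seq_event_io. Qed.

(** Comparison with the uniform distribution on words of length [t]. *)
Lemma law_ge_uniform (e : R) : 0 < e ->
  {ae P, forall w, exists N, forall t, (N <= t)%N ->
     expR (- ((ln #|B|%:R + e) * t%:R)) <= law (word (tr w) 0 t)}.
Proof.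
move=> e0; have B0 : 0 < #|B|%:R :> R by rewrite ltr0n card_letters_gt0.
have := @law_ge_subprobability _ _ _ P _ _ mW
  (fun t _ => expR (- (ln #|B|%:R * t%:R))) e.
have E t : expR (- (ln #|B|%:R * t%:R)) = (#|B|%:R ^+ t)^-1 :> R.
  by rewrite expRN expRM_natr lnK.
move=> H; apply: filterS (H _ _ e0) => [w [N HN]|t u|t].
- exists N => t /HN; apply: le_trans.
  by rewrite -expRD ler_expR mulrDl opprD addrC.
- exact: expR_ge0.
- rewrite E sumr_const card_tuple -[_ *+ _]mulr_natr natrX mulVf//.
  by rewrite expf_neq0// gt_eqF.
Qed.

(* [c] is the almost sure liminf of [- ln (law (word _ 0 t)) / t]. *)
Lemma exists_rate : exists c : R, [/\ 0 <= c,
  forall e, 0 < e -> {ae P, forall w, forall N, exists2 t, (N <= t)%N &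
    expR (- ((c + e) * t%:R)) <= law (word (tr w) 0 t)} &
  forall e, 0 < e -> {ae P, forall w, exists N, forall t, (N <= t)%N ->
    law (word (tr w) 0 t) <= expR (- ((c - e) * t%:R))}].
Proof.
(* The rates [a] such that almost surely, for every [k], the law exceeds [exp(-(a + 1/(k+1)) t)] at
   arbitrarily large [t]. The set contains [ln #|B|] and is bounded below by 0; its infimum is the
   rate sought. *)
pose S := [set a | Pr P (tr @^-1` (io V a)) = 1].
have S_ge0 a : S a -> 0 <= a.
  move=> Sa; rewrite leNgt; apply/negP => a0.
  have [k ka] : exists k : nat, k.+1%:R^-1 < - a.
    by apply: exists_natV_lt; rewrite oppr_gt0.
  suff io0 : io V a = set0.
    move: Sa; rewrite /S /= io0 preimage_set0 Pr_set0 => /esym/eqP.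
    by rewrite oner_eq0.
  apply/seteqP; split=> // s /(_ k 0%N)[t _]; rewrite /V /=.
  move=> /(lt_le_trans)/(_ (law_le1 _)); rewrite expR_lt1 oppr_lt0.
  rewrite ltNge => /negP; apply; rewrite mulr_le0_ge0//.
  by rewrite -lerBrDl sub0r ltW.
have S_ln : S (ln #|B|%:R).
  rewrite /S /=; apply/eqP; rewrite eq_le Pr_le1//= -{1}(Pr_setT P).
  apply: Pr_ae => //.
  have : {ae P, forall w, forall k : nat, exists N, forall t, (N <= t)%N ->
     expR (- ((ln #|B|%:R + k.+2%:R^-1) * t%:R)) <= law (word (tr w) 0 t)}.
    by apply: ae_foralln => k; apply: law_ge_uniform; rewrite invr_gt0.
  apply: filterS => w H _ k N; have [N0 HN0] := H k.
  exists (maxn N N0).+1; first by rewrite ltnW// ltnS leq_maxl.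
  rewrite /V /=; apply: lt_le_trans (HN0 _ _); last first.
    by rewrite ltnW// ltnS leq_maxr.
  by rewrite ltr_expR ltrN2 ltr_pM2r ?ltr0n// ltrD2l ltf_pV2 ?posrE// ltr_nat.
have S_inf : has_inf S.
  by split; [exists (ln #|B|%:R)|exists 0 => a /S_ge0].
exists (inf S); split.
- by apply: lb_le_inf; [exists (ln #|B|%:R)|move=> a /S_ge0].
- move=> e e0.
  have [a Sa ae] := inf_adherent (divr_gt0 e0 (ltr0Sn _ 1)) S_inf.
  have [k ke] := exists_natV_lt (divr_gt0 e0 (ltr0Sn R 1)).
  apply: filterS (Pr1_ae (mV a) Sa) => w /(_ k) H N.
  have [t Nt Vt] := H N; exists t => //.
  apply: le_trans (ltW Vt); rewrite ler_expR lerN2 ler_wpM2r//.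
  rewrite (le_trans (lerD (ltW ae) (ltW ke)))//.
  by rewrite -addrA -splitr.
- move=> e e0.
  (* Below the infimum probability 1 is excluded, so the zero-one law leaves probability 0. *)
  have /Pr0_ae : Pr P (tr @^-1` io V (inf S - e)) = 0.
    have [//|Se] := V_io_01 (inf S - e).
    have := ge_inf (proj2 S_inf) Se.
    by rewrite leNgt ltrBlDr ltrDl e0.
  move/(_ (mV _)); apply: filterS => w /existsNP[k] /existsNP[N] HN.
  exists N => t Nt; rewrite leNgt; apply: contra_notN HN => lt.
  exists t => //; rewrite /V /=; apply: le_lt_trans lt.
  by rewrite ler_expR lerN2 ler_wpM2r// lerDl invr_ge0.
Qed.

(** Archimedean property; it removes the bounded boundary term left by greedy parsing. *)
Lemma ler_linear (x y C : R) :
  (forall N : nat, x * N%:R <= y * N%:R + C) -> x <= y.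
Proof.
move=> H; rewrite leNgt; apply/negP => yx.
have [N HN] := exists_nat_ge ((C + 1) / (x - y)).
have := H N; rewrite -lerBlDl -mulrBl leNgt => /negP; apply.
rewrite mulrC -ltr_pdivrMr ?subr_gt0//; apply: lt_le_trans HN.
by rewrite ltr_pM2r ?invr_gt0 ?subr_gt0// ltrDl.
Qed.

(** A one-sided ergodic theorem. By the zero-one law, failure would mean that almost surely the
    frequency exceeds every rate below [eta] infinitely often. Most positions would then start a
    bounded stretch where [Q] is denser than its probability; parsing along such stretches and
    taking expectations contradicts stationarity. *)
Lemma frequency_le (Q : pred (seq B)) (m : nat) (eta : R) :
  Pr P [set w | Q (word (tr w) 0 m)] < eta ->
  {ae P, forall w, exists N, forall t, (N <= t)%N ->
     \sum_(0 <= i < t) (Q (word (tr w) i m))%:R <= eta * t%:R}.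
Proof.
move=> Qeta.
pose S t (s : nat -> B) : R := \sum_(0 <= i < t) (Q (word s i m))%:R.
(* The sign makes [U a t] weaken as [a] grows, as [io] requires; hence [io U (- eta)] below. *)
pose U (a : R) t : set (nat -> B) := [set s | - (a * t%:R) < S t s].
pose Su t (u : seq B) : R := \sum_(0 <= i < t) (Q (take m (drop i u)))%:R.
have take_drop_word s i k t : (i + m <= t)%N ->
    take m (drop i (word s k t)) = word s (k + i) m.
  move=> imt; rewrite -map_drop -map_take drop_iota take_iota.
  by rewrite (minn_idPl _) ?leq_subRL ?(leq_trans (leq_addr _ _) imt).
have SuE t s k l : (t + m <= l)%N ->
    Su t (word s k l) = \sum_(k <= i < k + t) (Q (word s i m))%:R.
  move=> tl; transitivity (\sum_(0 <= i < t) (Q (word s (i + k) m))%:R : R);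
    last first.
    by rewrite -{2}[k]add0n big_addn addKn.
  rewrite /Su !big_nat; apply: eq_bigr => i /andP[_ it].
  rewrite take_drop_word; first by rewrite addnC.
  by rewrite (leq_trans _ tl)// leq_add2r ltnW.
have sU a t : seq_event (U a t).
  rewrite [X in seq_event X](_ : _ =
    [set s | - (a * t%:R) < Su t (word s 0 (t + m))]).
    exact: (seq_event_word (fun u => - (a * t%:R) < Su t u)).
  by apply/seteqP; split=> s; rewrite /U /= SuE.
have S_shift t s : S t.+1 s <= S t (shift_seq s) + 1.
  rewrite /S big_nat_recl//= addrC lerD//; last by case: (Q _).
  by apply: ler_sum => i _; rewrite word_shift.
have [Qio|Qio] : Pr P (tr @^-1` (io U (- eta))) = 0 \/
                 Pr P (tr @^-1` (io U (- eta))) = 1.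
- apply: io_zero_one => // b c bc.
  have [N HN] := exists_nat_ge ((b + 1) / (c - b)).
  exists N => t s Nt; rewrite /U /= => Ut.
  have := lt_le_trans Ut (S_shift t s); rewrite -ltrBlDr; apply: le_lt_trans.
  rewrite -opprD lerN2 -natr1 mulrDr mulr1 -addrA -lerBrDl -mulrBl.
  rewrite -ler_pdivrMl ?subr_gt0// mulrC.
  by apply: le_trans HN _; rewrite ler_nat.
- have mU : measurable (tr @^-1` (io U (- eta))).
    by apply: measurable_trajectory => //; exact: seq_event_io.
  apply: filterS (Pr0_ae mU Qio) => w /existsNP[k] /existsNP[N] HN.
  exists N => t Nt; rewrite leNgt; apply: contra_notN HN => lt.
  exists t => //; rewrite /U /=; apply: le_lt_trans lt.
  by rewrite -mulNr opprD opprK ler_wpM2r// gerBl invr_ge0.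
exfalso; set q := Pr P _ in Qeta.
have [k kQ] : exists k : nat, k.+1%:R^-1 < eta - q.
  by apply: exists_natV_lt; rewrite subr_gt0.
pose a := eta - k.+1%:R^-1.
have qa : q < a by rewrite /a ltrBrDl addrC -ltrBrDl.
have a0 : 0 < a by apply: le_lt_trans qa; exact: Pr_ge0.
pose G M (u : seq B) := has (fun L => a * L%:R <= Su L u) (iota 1 M).
have GP M s l : G M (word s l (M + m)) <-> exists2 L, (0 < L <= M)%N &
    a * L%:R <= \sum_(l <= i < l + L) (Q (word s i m))%:R.
  split=> [/hasP[L]|[L LM aL]].
    rewrite mem_iota add1n ltnS => LM aL; exists L => //.
    by move: aL; rewrite SuE// leq_add2r; case/andP: LM.
  apply/hasP; exists L; first by rewrite mem_iota add1n ltnS.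
  by rewrite SuE// leq_add2r; case/andP: LM.
pose A M := [set w | G M (word (tr w) 0 (M + m))].
have mA M : measurable (A M) by exact: (measurable_word mW (G M)).
have ndA : nondecreasing_seq A.
  move=> M N MN; apply/subsetPset => w; rewrite /A /= => /GP[L /andP[L0 LM] aL].
  by apply/GP; exists L => //; rewrite L0 (leq_trans LM).
(* The cost is minus the number of occurrences of [Q]: a good stretch of length [L] costs at most
   [- a * L], any other position at most [- a + a = 0]. Taking expectations and letting [N] grow
   gives the bound. *)
have AM M : a * Pr P (A M) <= q.
  apply: (@ler_linear _ _ (a * M%:R)) => N.
  have mQ (i : nat) : measurable [set w | Q (word (tr w) i m)].
    exact: (measurable_word mW Q).
  have mG (i : nat) : measurable [set w | ~~ G M (word (tr w) i (M + m))].
    exact: (measurable_word mW (fun u => ~~ G M u)).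
  have := @Pr_lin_le _ _ _ P _ _ (index_iota 0 N) (index_iota 0 N) (fun=> -1)
    (fun=> a) _ _ (- a * N%:R + a * M%:R) mQ mG.
  have PG : Pr P [set w | ~~ G M (word (tr w) 0 (M + m))] = 1 - Pr P (A M).
    rewrite -PrC//; congr (Pr P _).
    by apply/seteqP; split=> w /negP.
  have -> : \sum_(0 <= i < N) -1 * Pr P [set w | Q (word (tr w) i m)] =
      - (q * N%:R).
    under eq_bigr do rewrite (Pr_word_shift mW sW).
    by rewrite sumr_const_nat subn0 -[LHS]mulr_natr mulN1r mulNr.
  have -> :
      \sum_(0 <= i < N) a * Pr P [set w | ~~ G M (word (tr w) i (M + m))] =
      a * (1 - Pr P (A M)) * N%:R.
    under eq_bigr do rewrite (Pr_word_shift mW sW (fun u => ~~ G M u)) PG.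
    by rewrite sumr_const_nat subn0 -[LHS]mulr_natr.
  set pA := Pr P (A M); suff H : forall w,
      \sum_(0 <= i < N) -1 * \1_[set w | Q (word (tr w) i m)] w <=
      \sum_(0 <= i < N) a * \1_[set w | ~~ G M (word (tr w) i (M + m))] w +
      (- a * N%:R + a * M%:R).
    by move/(_ H); lra.
  move=> w; rewrite -!mulr_sumr.
  under eq_bigr do rewrite indic_bool.
  under [X in _ <= _ * X + _]eq_bigr do rewrite indic_bool.
  have := @greedy_parse R (- a) a M (fun i => G M (word (tr w) i (M + m)))
    (fun l N => - \sum_(l <= i < l + N) (Q (word (tr w) i m))%:R)
    (ltW a0) _ _ _ 0%N N.
  rewrite !add0n => H; rewrite mulN1r addrCA -mulrDr; apply: H.
  - by move=> l; rewrite addn0 big_geq// oppr0.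
  - move=> l n; rewrite addNr add0r big_ltn; last first.
      by rewrite addnS ltnS leq_addr.
    by rewrite addSnnS lerN2 lerDr.
  - move=> l /GP[L LM aL]; exists L => // n.
    rewrite (@big_cat_nat _ _ _ (l + L)) ?leq_addr//=; last first.
      by rewrite leq_add2l leq_addr.
    by rewrite addnA opprD mulNr lerD2r lerN2.
have e0 : 0 < 1 - q / a by rewrite subr_gt0 ltr_pdivrMr// mul1r.
have Aae : {ae P, forall w, exists M, A M w}.
  have mU : measurable (tr @^-1` (io U (- eta))).
    by apply: measurable_trajectory => //; exact: seq_event_io.
  apply: filterS (Pr1_ae mU Qio) => w /(_ k 1%N)[t t1].
  rewrite /U /= -mulNr opprD opprK -/a => /ltW aS.
  by exists t; apply/GP; exists t; rewrite ?t1 ?leqnn// add0n.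
have [M] := ae_nondecreasing_Pr mA ndA e0 Aae.
by rewrite opprB addrC subrK ltNge ler_pdivlMr// mulrC AM.
Qed.

End Rate.

(** * The Shannon-McMillan-Breiman theorem *)

Lemma ler_wln {R : realType} (x y : R) : 0 < x -> x <= y -> ln x <= ln y.
Proof. by move=> x0 xy; rewrite ler_ln ?posrE// (lt_le_trans x0). Qed.

Section SMB.
Context {R : realType} {d : measure_display} {T : measurableType d}.
Variable P : probability T R.
Context {B : finType}.
Variable W : nat -> T -> B.
Hypothesis mW : process W.
Hypothesis sW : stationary P W.
Local Notation tr := (trajectory W).
Local Notation law := (law P W).

(** [q] is [block_code] with blocks drawn from the law itself. A position is bad when no word of
    length [L] from [M0] to [M] starting there has law at least [exp(-(c + e/3) L)]. [K] is the
    price of a single letter, and [C = K * M] accounts for the tail. *)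
Lemma exists_code (c e : R) : 0 <= c -> 0 < e ->
  (forall e, 0 < e -> {ae P, forall w, forall N, exists2 t, (N <= t)%N &
    expR (- ((c + e) * t%:R)) <= law (word (tr w) 0 t)}) ->
  exists (q : nat -> seq B -> R) (C K : R) (m : nat) (bad : pred (seq B)),
    [/\ (forall t u, 0 <= q t u) /\ (forall t (u : t.-tuple B), 0 < q t u),
        forall t, \sum_(u : t.-tuple B) q t u <= 1,
        0 < K,
        K * Pr P [set w | bad (word (tr w) 0 m)] < e &
        forall s N, - ln (q N (word s 0 N)) <= (c + e) * N%:R +
          K * \sum_(0 <= i < N) (bad (word s i m))%:R + C].
Proof.
move=> c0 e0 ioc; pose e' := e / 3; have e'0 : 0 < e' by rewrite divr_gt0.
have B0 : 1 <= #|B|%:R :> R by rewrite ler1n (card_letters_gt0 W).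
pose r := expR (- e').
have r0 : 0 < r by exact: expR_gt0.
have r1 : r < 1 by rewrite expR_lt1 oppr_lt0.
(* Single letters get total weight 1/2 and blocks a geometric weight of total at most 1/2. *)
pose alpha : R := (2 * #|B|%:R)^-1.
have alpha0 : 0 < alpha by rewrite invr_gt0; lra.
pose beta (L : nat) : R := r ^+ L * ((1 - r) / 2).
have beta0 L : 0 < beta L by rewrite mulr_gt0 ?exprn_gt0// divr_gt0// subr_gt0.
have weights1 N : alpha * #|B|%:R + \sum_(1 <= L < N) beta L <= 1.
  have -> : alpha * #|B|%:R = 2^-1 by rewrite /alpha invfM mulfVK//; lra.
  rewrite -mulr_suml; case: N => [|N]; first by rewrite big_geq// mul0r; lra.
  have -> : \sum_(1 <= L < N.+1) r ^+ L = r * (1 - r ^+ N) / (1 - r).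
    rewrite -[N.+1]add1n geometric_partial_tail geometric_seriesE ?lt_eqF//.
  rewrite mulrA divfK ?subr_eq0 ?gt_eqF//.
  have : 0 <= r * r ^+ N by rewrite mulr_ge0 ?exprn_ge0// ltW.
  by rewrite mulrBr mulr1; lra.
pose K := - ln alpha.
have K0 : 0 < K by rewrite oppr_gt0 ln_lt0// alpha0 invf_lt1; lra.
(* From length [M0] on, the constant part of [- ln (beta L)] is at most [e' * L]. With [e'] per
   letter from the geometric part and [e'] from the law of the block, the overhead is
   [3 * e' = e]. *)
have [M0 HM0] := exists_nat_ge (Num.max 1 (- ln ((1 - r) / 2) / e')).
have M0_gt0 : (0 < M0)%N.
  by rewrite -(ltr_nat R) (lt_le_trans ltr01)// (le_trans _ HM0)// le_max lexx.
have beta_cost L : (M0 <= L)%N -> - ln (beta L) <= 2 * e' * L%:R.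
  move=> ML; have HL : - ln ((1 - r) / 2) <= e' * L%:R.
    rewrite [e' * _]mulrC -ler_pdivrMr//.
    apply: (@le_trans _ _ M0%:R); last by rewrite ler_nat.
    by rewrite (le_trans _ HM0)// le_max lexx orbT.
  rewrite lnM ?posrE ?exprn_gt0 ?divr_gt0 ?subr_gt0// -expRM_natr expRK.
  lra.
pose G M (u : seq B) := has (fun L => (M0 <= L)%N &&
  (expR (- ((c + e') * L%:R)) <= law (take L u))) (iota 1 M).
have GP M s k : G M (word s k M) <-> exists L,
    [/\ (M0 <= L)%N, (0 < L <= M)%N &
        expR (- ((c + e') * L%:R)) <= law (word s k L)].
  split=> [/hasP[L]|[L [ML LM pL]]].
    rewrite mem_iota add1n ltnS => LM /andP[ML pL]; exists L; split => //.
    by move: pL; rewrite take_word//; case/andP: LM.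
  apply/hasP; exists L; first by rewrite mem_iota add1n ltnS.
  by rewrite ML take_word//; case/andP: LM.
pose A M := [set w | G M (word (tr w) 0 M)].
have mA M : measurable (A M) by exact: (measurable_word mW (G M)).
have ndA : nondecreasing_seq A.
  move=> M N MN; apply/subsetPset => w; rewrite /A /=.
  move=> /GP[L [ML /andP[L0 LM] pL]].
  by apply/GP; exists L; split=> //; rewrite L0 (leq_trans LM).
have Aae : {ae P, forall w, exists M, A M w}.
  apply: filterS (ioc _ e'0) => w /(_ M0)[t Mt pt].
  by exists t; apply/GP; exists t; rewrite leqnn (leq_trans M0_gt0).
have [M AM] := ae_nondecreasing_Pr mA ndA (divr_gt0 e0 K0) Aae.
have law0 u : 0 <= law u by exact: law_ge0.
pose q := block_code alpha beta law.
exists q, (K * M%:R), K, M, (fun u => ~~ G M u); split => //.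
- split=> [t u|t u]; first by apply: block_code_ge0 => // [|L]; exact: ltW.
  rewrite -{1}(size_tuple u); apply: block_code_gt0 => // [|L]; exact: ltW.
- move=> t; apply: sum_block_code => // [|L|L]; [exact: ltW|exact: ltW|].
  by rewrite sum_law.
- rewrite mulrC -ltr_pdivlMr//.
  rewrite [X in Pr P X](_ : _ = ~` A M); last by apply/seteqP; split=> w /negP.
  by rewrite PrC//; lra.
move=> s N.
have codeN k t : q t (word s k t) = q (size (word s k t)) (word s k t).
  by rewrite size_word.
have code0 k t : 0 < q t (word s k t).
  by rewrite codeN; apply: block_code_gt0 => // [|L]; exact: ltW.
rewrite -addrA -mulrDr.
have := @greedy_parse R (c + e) K M (fun i => G M (word s i M))
  (fun k t => - ln (q t (word s k t))) (ltW K0) _ _ _ 0%N N.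
rewrite add0n; apply.
- by move=> k; rewrite /= ln1 oppr0.
- move=> k n; rewrite {1}/K.
  have H : alpha * q n (word s k.+1 n) <= q n.+1 (word s k n.+1).
    have := @block_code_single _ _ alpha beta law (ltW alpha0) _ _
      (s k) (word s k.+1 n).
    by rewrite size_word; apply => // L; exact: ltW.
  have := ler_wln (mulr_gt0 alpha0 (code0 _ _)) H.
  rewrite (lnM alpha0 (code0 _ _)).
  lra.
- move=> k /GP[L [ML /andP[L0 LM] pL]]; exists L; first by rewrite L0.
  move=> n.
  have pL0 : 0 < law (word s k L) by apply: lt_le_trans pL; exact: expR_gt0.
  have H : beta L * law (word s k L) * q n (word s (k + L) n) <=
           q (L + n) (word s k (L + n)).
    have := @block_code_block _ _ alpha beta law (ltW alpha0) _ _
      L (word s k (L + n)).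
    rewrite size_word take_word ?leq_addr// addKn.
    rewrite wordD drop_size_cat ?size_word//.
    by apply => //; [move=> ?; exact: ltW|rewrite L0].
  have bl0 := mulr_gt0 (beta0 L) pL0.
  have := ler_wln (mulr_gt0 bl0 (code0 _ _)) H.
  rewrite (lnM bl0 (code0 _ _)) (lnM (beta0 L) pL0).
  have := ler_wln (expR_gt0 _) pL; rewrite expRK.
  have := beta_cost _ ML; rewrite /e'; lra.
Qed.

End SMB.

Lemma Pr_block_law {R : realType} {d} {T : measurableType d}
    (P : probability T R) (B : finType) (W : nat -> T -> B) t (u : t.-tuple B) :
  Pr P [set w | block W 0 t w = u] = law P W u.
Proof.
by rewrite block_eqE Pr_word_law.
Qed.

Section SMB.
Context {R : realType} {d : measure_display} {T : measurableType d}.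
Variable P : probability T R.
Context {B : finType}.
Variable W : nat -> T -> B.
Hypothesis mW : process W.
Local Notation tr := (trajectory W).
Local Notation law := (law P W).

Definition block_entropy (t : nat) : R :=
  \sum_(u : t.-tuple B) law u * - ln (law u).

Lemma entropy_mE m :
  entropy_m P W m = block_entropy m.+1 / m.+1%:R / ln 2.
Proof.
rewrite /entropy_m mulNr -mulrN -sumrN mulrC /block_entropy !mulr_suml.
apply: eq_bigr => u _; rewrite Pr_block_law /log2; ring.
Qed.

(** Markov's inequality for the nonnegative variable [- ln (law (W_1 ... W_t))], whose expectation
    is [block_entropy t]. *)
Lemma ler_sum_law_block_entropy (a : R) t : 0 <= a ->
  a * Pr P [set w | law (word (tr w) 0 t) <= expR (- a)] <= block_entropy t.
Proof.
move=> a0; rewrite (Pr_word P mW (fun u => law u <= expR (- a))) mulr_sumr.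
rewrite [leRHS](bigID (fun u : t.-tuple B => law u <= expR (- a)))/=.
rewrite ler_wpDr ?sumr_ge0// => [u _|].
  by rewrite mulr_ge0 ?law_ge0// oppr_ge0 ln_le0// law_le1.
apply: ler_sum => u ua; rewrite Pr_word_law mulrC.
have := law_ge0 P W u; rewrite le_eqVlt => /predU1P[<-|u0].
  by rewrite !mul0r.
apply: ler_wpM2l; first exact: ltW.
by rewrite lerNr -[leRHS](expRK (- a)) ler_wln.
Qed.

Hypothesis sW : stationary P W.

Section Bounds.
Variable c : R.
Hypothesis c0 : 0 <= c.
Hypothesis io_c : forall e, 0 < e -> {ae P, forall w, forall N,
  exists2 t, (N <= t)%N & expR (- ((c + e) * t%:R)) <= law (word (tr w) 0 t)}.

Lemma law_ge_rate (e : R) : ergodic P W -> 0 < e ->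
  {ae P, forall w, exists N, forall t, (N <= t)%N ->
    expR (- ((c + e) * t%:R)) <= law (word (tr w) 0 t)}.
Proof.
(* A quarter of [e] each goes to the rate of the code, the bad positions, the constant [C] and the
   Borel-Cantelli loss. *)
move=> eW e0; have e4 : 0 < e / 4 by rewrite divr_gt0.
have [q [C [K [m [bad [[q0 q_gt0] q1 K0 Kbad costq]]]]]] :=
  exists_code mW c0 e4 io_c.
have badK : Pr P [set w | bad (word (tr w) 0 m)] < e / 4 / K.
  by rewrite ltr_pdivlMr// mulrC.
have [N1 HN1] := exists_nat_ge (C / (e / 4)).
have := frequency_le mW sW eW badK.
have := law_ge_subprobability P mW q0 q1 e4.
apply: filterS2 => w [N2 HN2] [N3 HN3].
exists (maxn N1 (maxn N2 N3)) => t; rewrite !geq_max => /and3P[t1 t2 t3].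
apply: le_trans (HN2 _ t2).
have qw : 0 < q t (word (tr w) 0 t).
  have sz : size (word (tr w) 0 t) == t by rewrite size_word.
  exact: (q_gt0 t (Tuple sz)).
rewrite -[X in _ <= _ * X](lnK qw) -expRD ler_expR.
have Kt : K * (e / 4 / K * t%:R) = e / 4 * t%:R by field; rewrite gt_eqF.
have := costq (tr w) t.
have := ler_wpM2l (ltW K0) (HN3 _ t3); rewrite Kt.
have : C <= e / 4 * t%:R.
  rewrite mulrC -ler_pdivrMr//; apply: le_trans HN1 _; by rewrite ler_nat.
lra.
Qed.

(** Gibbs' inequality against the code [q]; by stationarity the expected number of bad positions is
    [t] times their probability, which adds at most [e / 2] per letter. *)
Lemma block_entropy_le (e : R) : 0 < e ->
  exists C, forall t, block_entropy t <= (c + e) * t%:R + C.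
Proof.
move=> e0; have e2 : 0 < e / 2 by rewrite divr_gt0.
have [q [C [K [m [bad [[q0 q_gt0] q1 K0 Kbad costq]]]]]] :=
  exists_code mW c0 e2 io_c.
exists C => t.
apply: (@le_trans _ _ (\sum_(u : t.-tuple B) law u * - ln (q t u))).
  by apply: gibbs => // [u|]; [exact: law_ge0|rewrite sum_law].
have mu (u : t.-tuple B) : measurable [set w | word (tr w) 0 t = u].
  exact: measurable_word_eq.
have mbad (i : nat) : measurable [set w | bad (word (tr w) i m)].
  exact: (measurable_word mW bad).
have := @Pr_lin_le _ _ _ P _ _ (index_enum (t.-tuple B)) (index_iota 0 t)
  (fun u => - ln (q t u)) (fun=> K) _ _ ((c + e / 2) * t%:R + C) mu mbad.
under eq_bigr do rewrite Pr_word_law mulrC.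
have -> : \sum_(0 <= i < t) K * Pr P [set w | bad (word (tr w) i m)] =
    K * Pr P [set w | bad (word (tr w) 0 m)] * t%:R.
  under eq_bigr do rewrite (Pr_word_shift mW sW).
  by rewrite sumr_const_nat subn0 -[LHS]mulr_natr.
move=> H.
apply: (le_trans (H _)).
  move=> w; rewrite (sum_indic_word W (fun u => - ln (q t u))) -mulr_sumr.
  under eq_bigr do rewrite indic_bool.
  by have := costq (tr w) t; lra.
have := ler_wpM2r (ler0n R t) (ltW Kbad); lra.
Qed.

End Bounds.

Lemma block_entropy_ge (c e : R) : 0 <= c -> 0 < e ->
  (forall e, 0 < e -> {ae P, forall w, exists N, forall t, (N <= t)%N ->
    law (word (tr w) 0 t) <= expR (- ((c - e) * t%:R))}) ->
  exists N, forall t, (N <= t)%N -> (c - e) * t%:R <= block_entropy t.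
Proof.
move=> c0 e0 H; have e2 : 0 < e / 2 by rewrite divr_gt0.
have [ce|ec] := leP c e.
  exists 0%N => t _; apply: (@le_trans _ _ 0).
    by rewrite mulr_le0_ge0// subr_le0.
  apply: sumr_ge0 => u _.
  by rewrite mulr_ge0 ?law_ge0// oppr_ge0 ln_le0// law_le1.
pose Q t u := law u <= expR (- ((c - e / 2) * t%:R)).
pose A N := [set w | forall t, (N <= t)%N -> Q t (word (tr w) 0 t)].
have mQ t : measurable [set w | Q t (word (tr w) 0 t)].
  exact: (measurable_word mW (Q t)).
have mA N : measurable (A N).
  rewrite [X in measurable X](_ : _ =
    \bigcap_(t in [set t | (N <= t)%N]) [set w | Q t (word (tr w) 0 t)]).
    exact: bigcap_measurableType.
  by apply/seteqP; split.
have ndA : nondecreasing_seq A.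
  move=> M N MN; apply/subsetPset => w Aw t Nt; apply: Aw.
  exact: leq_trans Nt.
(* This exceptional probability costs at most [c * (e / 2 / (c + 1)) <= e / 2] in the rate; the
   other half of [e] is spent in [Q]. *)
have eta0 : 0 < e / 2 / (c + 1) by rewrite divr_gt0// ltr_wpDl.
have [N AN] := ae_nondecreasing_Pr mA ndA eta0 (H _ e2).
exists N => t Nt.
have ct0 : 0 <= (c - e / 2) * t%:R by rewrite mulr_ge0//; lra.
apply: le_trans (ler_sum_law_block_entropy t ct0).
have AQ : Pr P (A N) <= Pr P [set w | Q t (word (tr w) 0 t)].
  by apply: le_Pr => // w; exact.
have ct : (c - e) * t%:R <= (c - e / 2) * t%:R * (1 - e / 2 / (c + 1)).
  rewrite mulrAC ler_wpM2r//.
  have : c * (e / 2 / (c + 1)) <= e / 2.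
    rewrite mulrCA; apply: ler_piMr; first exact: ltW.
    by rewrite ler_pdivrMr ?mul1r; lra.
  have : 0 <= e / 2 * (e / 2 / (c + 1)) by apply: mulr_ge0; exact: ltW.
  lra.
apply: le_trans ct _; apply: ler_wpM2l => //.
exact: ltW (lt_le_trans AN AQ).
Qed.

Hypothesis eW : ergodic P W.

(** The rate [c] is in nats, whence the factor [ln 2]. The upper bound on the law comes from
    [exists_rate], the lower one from [law_ge_rate], and the block entropies are squeezed at the
    same rate. *)
Theorem shannon_mcmillan_breiman : exists c : R, [/\ 0 <= c,
  forall e, 0 < e -> {ae P, forall w, exists N, forall t, (N <= t)%N ->
    expR (- ((c + e) * t%:R)) <= law (word (tr w) 0 t)
      <= expR (- ((c - e) * t%:R))} &
  entropy_m P W @ \oo --> c / ln 2].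
Proof.
have [c [c0 ioc lec]] := exists_rate mW sW eW; exists c; split => // [e e0|].
  have := law_ge_rate c0 ioc eW e0; have := lec _ e0.
  apply: filterS2 => w [N1 H1] [N2 H2].
  exists (maxn N1 N2) => t; rewrite geq_max => /andP[t1 t2].
  by rewrite H1// H2.
rewrite (_ : entropy_m P W =
    fun m => block_entropy m.+1 / m.+1%:R / ln 2); last first.
  by apply/funext => m; exact: entropy_mE.
apply: cvgMr_tmp; apply/cvgrPdist_le => /= e e0.
have [C HC] := block_entropy_le c0 ioc (divr_gt0 e0 (ltr0Sn R 1)).
have [N1 HN1] := block_entropy_ge c0 e0 lec.
have [N2 HN2] := exists_nat_ge (C / (e / 2)).
exists (maxn N1 N2) => // m /=; rewrite geq_max => /andP[m1 m2].
have m0 : (0 : R) < m.+1%:R by rewrite ltr0n.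
have : block_entropy m.+1 / m.+1%:R <= c + e.
  rewrite ler_pdivrMr//; apply: le_trans (HC _) _.
  have : C <= e / 2 * m.+1%:R.
    rewrite mulrC -ler_pdivrMr ?divr_gt0//; apply: le_trans HN2 _.
    by rewrite ler_nat ltnW.
  lra.
have : c - e <= block_entropy m.+1 / m.+1%:R.
  by rewrite ler_pdivlMr//; apply: HN1; rewrite ltnW.
by move=> h1 h2; rewrite ler_distlC h1 h2.
Qed.

End SMB.

(** * Conditional probabilities given the ciphertext *)

Lemma limn_einf_ge {R : realType} (u : (\bar R)^nat) (a : R) :
  (forall e, 0 < e -> exists N, forall t, (N <= t)%N ->
     ((a - e)%:E <= u t)%E) ->
  (a%:E <= limn_einf u)%E.
Proof.
move=> H; apply/lee_subgt0Pr => e /H[N HN].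
rewrite limn_einf_lim; apply: le_trans (_ : (einfs u N <= _)%E).
  by apply: le_ereal_inf_tmp => _ [t /= Nt <-]; exact: HN.
have /cvg_lim -> // := @cvg_einfs_sup R u.
by apply: ereal_sup_ubound; exists N.
Qed.

Section Filtering.
Context {R : realType} {d : measure_display} {T : measurableType d}.
Variable P : probability T R.
Context {B : finType}.
Variable Z : nat -> T -> B.
Hypothesis mZ : process Z.
Local Notation tr := (trajectory Z).

(* Doob's maximal inequality for the martingale [P(D | Z_1 ... Z_t)]: decompose
   according to the first time the conditional probability exceeds [delta]. *)
Lemma maximal_inequality (C : nat -> set T) (bad : nat -> pred (seq B))
    (delta : R) (N : nat) : 0 <= delta -> (forall t, measurable (C t)) ->
  (forall t (u : t.-tuple B), bad t u ->
     delta * Pr P [set w | word (tr w) 0 t = u]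
     <= Pr P (C t `&` [set w | word (tr w) 0 t = u])) ->
  (delta%:E * P (\bigcup_(t in [set t | (N <= t)%N])
                   [set w | bad t (word (tr w) 0 t)])
   <= P (\bigcup_(t in [set t | (N <= t)%N]) C t))%E.
Proof.
move=> delta0 mC badC.
(* Being the first bad time from [N] on is decided by the word of length [t], so [badC] can be
   summed over words to give [FC]. *)
pose first t (u : seq B) := [&& (N <= t)%N, bad t u &
  all (fun s => ~~ bad s (take s u)) (iota N (t - N))].
pose F t := [set w | first t (word (tr w) 0 t)].
have firstP t w : F t w <-> [/\ (N <= t)%N, bad t (word (tr w) 0 t) &
    forall s, (N <= s < t)%N -> ~~ bad s (word (tr w) 0 s)].
  split=> [/and3P[Nt bt /allP H]|[Nt bt H]].
    split=> // s /andP[Ns st]; rewrite -(take_word _ _ (ltnW st)); apply: H.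
    by rewrite mem_iota Ns subnKC.
  apply/and3P; split => //; apply/allP => s; rewrite mem_iota subnKC// => Nst.
  by rewrite take_word; [exact: H|case/andP: Nst => _ /ltnW].
have mF t : measurable (F t) by exact: (measurable_word mZ (first t)).
have tF : trivIset setT F.
  apply/trivIsetP => s t _ _ st; apply/seteqP; split=> // w [/firstP[Ns bs Hs]].
  move=> /firstP[Nt bt Ht].
  have [lt|lt|eq] := ltngtP s t; last by move: st; rewrite eq eqxx.
    by have := Ht s; rewrite Ns lt bs => /(_ isT).
  by have := Hs t; rewrite Nt lt bt => /(_ isT).
have tCF : trivIset setT (fun t => C t `&` F t).
  apply/trivIsetP => s t _ _ st.
  move/trivIsetP : tF => /(_ s t Logic.I Logic.I st).
  by rewrite setIACA => ->; rewrite setI0.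
have mCF t : measurable (C t `&` F t) by exact: measurableI.
have FC t : (delta%:E * P (F t) <= P (C t `&` F t))%E.
  rewrite -!PrK// -EFinM lee_fin (Pr_word P mZ) (Pr_wordI P mZ)// mulr_sumr.
  by apply: ler_sum => u /and3P[_ bu _]; exact: badC.
have -> :
    \bigcup_(t in [set t | (N <= t)%N]) [set w | bad t (word (tr w) 0 t)] =
    \bigcup_t F t.
  apply/seteqP; split=> w [t /= Nt bt]; last first.
    by exists t; move/firstP: bt => [].
  have ex : exists t, (N <= t)%N && bad t (word (tr w) 0 t).
    by exists t; rewrite Nt.
  exists (ex_minn ex) => //; case: ex_minnP => s /andP[Ns bs] min.
  apply/firstP; split => // r /andP[Nr rs]; apply/negP => br.
  by have := min r; rewrite Nr br leqNgt rs => /(_ isT).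
rewrite measure_bigcup// -nneseriesZl//.
apply: le_trans (lee_nneseries _ (fun t _ => FC t)) _.
  by move=> t _ _; rewrite mule_ge0.
rewrite -(measure_bigcup P setT (fun t => C t `&` F t))//.
apply: le_measure; rewrite ?inE.
- by apply: bigcup_measurable => t _; exact: mCF.
- by apply: bigcup_measurable.
- by move=> w [t _ [Ct /firstP[Nt _ _]]]; exists t.
Qed.

(** The union of the [C t] over [t >= N] has probability tending to 0. By the maximal inequality so
    does the probability that the conditional probability of some [C t] with [t >= N] exceeds
    [delta]. *)
Lemma conditional_probability_cvg0 (C : nat -> set T) (delta : R) :
  0 < delta -> (forall t, measurable (C t)) ->
  {ae P, forall w, exists N, forall t, (N <= t)%N -> ~ C t w} ->
  {ae P, forall w, exists N, forall t, (N <= t)%N ->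
    Pr P (C t `&` [set w' | word (tr w') 0 t = word (tr w) 0 t])
    <= delta * law P Z (word (tr w) 0 t)}.
Proof.
move=> delta0 mC Cae.
pose bad t (u : seq B) := delta * law P Z u <
  Pr P (C t `&` [set w | word (tr w) 0 t = u]).
pose D N := \bigcup_(t in [set t | (N <= t)%N]) C t.
have mD N : measurable (D N) by exact: bigcup_measurable.
pose G N :=
  \bigcup_(t in [set t | (N <= t)%N]) [set w | bad t (word (tr w) 0 t)].
have mG N : measurable (G N).
  by apply: bigcup_measurable => t _; exact: (measurable_word mZ (bad t)).
have GD N : delta * Pr P (G N) <= Pr P (D N).
  rewrite -lee_fin EFinM !PrK//; apply: maximal_inequality => //.
    exact: ltW.
  by move=> t u /ltW; rewrite Pr_word_law.
have ndC : nondecreasing_seq (fun N => ~` (D N)).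
  move=> M N MN; apply/subsetPset => w; apply: subsetC => {}w [t /= Nt Ct].
  by exists t => //=; exact: leq_trans Nt.
have DCae : {ae P, forall w, exists N, (~` (D N)) w}.
  by apply: filterS Cae => w [N HN]; exists N => -[t /= /HN].
have mE : measurable (\bigcap_N G N) by exact: bigcapT_measurable.
have E0 : Pr P (\bigcap_N G N) = 0.
  apply/eqP; rewrite eq_le Pr_ge0 andbT -(pmulr_rle0 _ delta0).
  apply/ler_addgt0Pr => e e0; rewrite add0r.
  have [N HN] := ae_nondecreasing_Pr (fun N => measurableC (mD N)) ndC e0 DCae.
  apply: le_trans (_ : delta * Pr P (G N) <= _).
    apply: ler_wpM2l; first exact: ltW.
    by apply: le_Pr => //; exact: bigcap_inf.
  apply: le_trans (GD N) _.
  by move: HN; rewrite PrC// ltrD2l ltrN2 => /ltW.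
apply: filterS (Pr0_ae mE E0) => w /existsNP[N] /not_implyP[_ HN].
exists N => t Nt; rewrite leNgt; apply: contra_notN HN => bt.
by exists t.
Qed.

End Filtering.

(** * The running-key cipher *)

Lemma measurable_block {d} {T : measurableType d} (B : finType)
    (W : nat -> T -> B) k t (Q : t.-tuple B -> Prop) :
  process W -> measurable [set w | Q (block W k t w)].
Proof.
move=> mW; rewrite [X in measurable X](_ : _ = \bigcup_(u in [set u | Q u])
    [set w | word (trajectory W w) k t = u]).
  by apply: fin_bigcup_measurable => // u _; exact: measurable_word_eq.
apply/seteqP; split=> [w Qw|w [u Qu]]; last by rewrite -block_eqE /= => ->.
by exists (block W k t w); rewrite //= tval_block.
Qed.

Lemma Pr_blockI {R : realType} {d} {T : measurableType d}
    (P : probability T R) (B : finType) (W : nat -> T -> B) (A : set T) k t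
    (S : {set t.-tuple B}) :
  process W -> measurable A ->
  Pr P ([set w | block W k t w \in S] `&` A) =
  \sum_(u in S) Pr P ([set w | block W k t w = u] `&` A).
Proof.
move=> mW mA.
have := Pr_wordI P mW (fun u => u \in [seq val v | v <- enum S]) k t mA.
have E u : (val u \in [seq val v | v <- enum S]) = (u \in S).
  by rewrite mem_map ?mem_enum//; exact: val_inj.
rewrite (eq_bigl (mem S)) => [|u]; last exact: E.
move=> H.
transitivity (Pr P ([set w | word (trajectory W w) k t
    \in [seq val v | v <- enum S]] `&` A)).
  congr (Pr P (_ `&` A)); apply/seteqP; split=> w /=;
    by rewrite -tval_block (E (block W k t w)).
by rewrite setIC H; apply: eq_bigr => u _; rewrite setIC block_eqE.
Qed.

Section RunningKey.
Context {R : realType} {d : measure_display} {T : measurableType d}.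
Variable P : probability T R.
Context {B : finZmodType}.
Variables X Y Z : nat -> T -> B.
Hypotheses (mX : process X) (mY : process Y).
Hypotheses (sX : stationary P X) (sY : stationary P Y).
Hypothesis indXY : independent_processes P X Y.
Hypothesis ZE : forall i w, Z i w = X i w + Y i w.

Definition sub_tuple t (z x : t.-tuple B) : t.-tuple B :=
  [tuple tnth z i - tnth x i | i < t].

Lemma block_cipher k t w :
  block Y k t w = sub_tuple (block Z k t w) (block X k t w).
Proof. by apply: eq_from_tnth => i; rewrite !tnth_mktuple ZE addrC addKr. Qed.

Lemma block_plaintext_cipher k t (x z : t.-tuple B) :
  [set w | block X k t w = x] `&` [set w | block Z k t w = z] =
  [set w | block X k t w = x] `&` [set w | block Y k t w = sub_tuple z x].
Proof.
apply/seteqP; split=> w /= [Xx YZ]; split=> //.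
  by rewrite block_cipher Xx YZ.
apply: eq_from_tnth => i; have := congr1 (fun u => tnth u i) YZ.
by rewrite -Xx !tnth_mktuple => H; rewrite ZE H addrC subrK.
Qed.

Lemma process_joint : process (joint X Y).
Proof.
move=> i [a b].
rewrite [X in measurable X](_ : _ = X i @^-1` [set a] `&` Y i @^-1` [set b]).
  by apply: measurableI; [exact: mX|exact: mY].
by apply/seteqP; split=> w [<- <-].
Qed.

Lemma process_cipher : process Z.
Proof.
move=> i b; have := measurable_word process_joint
  (fun u : seq (B * B) => exists v, u = [:: v] /\ v.1 + v.2 = b) i 1.
congr measurable; apply/seteqP; split=> w /=; rewrite ZE.
  by case=> v [[<-]].
by move=> XY; exists (X i w, Y i w).
Qed.

Lemma Pr_independent_blocks k t (x y : t.-tuple B) :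
  Pr P ([set w | block X k t w = x] `&` [set w | block Y k t w = y]) =
  Pr P [set w | block X k t w = x] * Pr P [set w | block Y k t w = y].
Proof.
have E (W : nat -> T -> B) u : [set w | block W k t w = u] =
    trajectory W @^-1` [set s | word s k t = u].
  exact: block_eqE.
by rewrite !E; apply: indXY; exact: (seq_event_word (fun v => v = _)).
Qed.

Lemma Pr_plaintext_cipher t (x z : t.-tuple B) :
  Pr P ([set w | block X 0 t w = x] `&` [set w | block Z 0 t w = z]) =
  law P X x * law P Y (sub_tuple z x).
Proof.
by rewrite block_plaintext_cipher Pr_independent_blocks !Pr_block_law.
Qed.

Lemma Pr_cipher k t (z : t.-tuple B) : Pr P [set w | block Z k t w = z] =
  \sum_(x : t.-tuple B) Pr P [set w | block X k t w = x] *
     Pr P [set w | block Y k t w = sub_tuple z x].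
Proof.
have mZ : measurable [set w | block Z k t w = z].
  exact: (measurable_block k (fun u => u = z) process_cipher).
transitivity (Pr P ([set w | block X k t w \in [set: t.-tuple B]%SET] `&`
    [set w | block Z k t w = z])).
  congr (Pr P _); apply/seteqP; split=> w /=; last by case.
  by move=> Zz; split; rewrite ?inE.
rewrite Pr_blockI//; apply: eq_big => [x|x _]; first by rewrite inE.
by rewrite block_plaintext_cipher Pr_independent_blocks.
Qed.

(** The convolution formula [Pr_cipher] involves [k] only through the laws of [X] and [Y]. *)
Lemma stationary_cipher : stationary P Z.
Proof.
move=> k t z; rewrite !Pr_cipher; apply: eq_bigr => x _.
by rewrite sX sY.
Qed.

(** The bijection [(x, y) -> (x, x + y)] on blocks carries the product of the laws of [X] and [Y] to
    the joint law of plaintext and ciphertext. *)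
Lemma entropy_m_plaintext_cipher m :
  entropy_m P (joint X Z) m = entropy_m P X m + entropy_m P Y m.
Proof.
rewrite /entropy_m -mulrDr; congr (_ * _); set t := m.+1.
pose h (xy : t.-tuple B * t.-tuple B) : t.-tuple (B * B) :=
  [tuple (tnth xy.1 i, tnth xy.1 i + tnth xy.2 i) | i < t].
have h_inj : injective h.
  move=> [x y] [x' y'] /= hh; have H i := congr1 (fun u => tnth u i) hh.
  congr pair; apply: eq_from_tnth => i; have := H i; rewrite !tnth_mktuple /=.
    by case.
  by case=> ->; exact: addrI.
have h_bij : bijective h.
  apply: inj_card_bij => //.
  by rewrite card_prod !card_tuple card_prod expnMn.
rewrite (reindex h)/=; last exact: onW_bij.
have Ph x y : Pr P [set w | block (joint X Z) 0 t w = h (x, y)] =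
    law P X x * law P Y y.
  rewrite -!Pr_block_law -Pr_independent_blocks; congr (Pr P _).
  apply/seteqP; split=> w /=.
    move=> H; split; apply: eq_from_tnth => i;
      have := congr1 (fun u => tnth u i) H;
      rewrite !tnth_mktuple /joint ZE => -[//].
    by move=> ->; exact: addrI.
  move=> [Xx Yy]; apply: eq_from_tnth => i; rewrite !tnth_mktuple /joint ZE /=.
  by rewrite -Xx -Yy !tnth_mktuple.
rewrite (eq_bigr (fun xy : t.-tuple B * t.-tuple B =>
    law P X xy.1 * law P Y xy.2 *
    (log2 (law P X xy.1) + log2 (law P Y xy.2)))) => [|[x y] _]; last first.
  (* Vanishing laws are split off, since [ln] of a product splits only for positive factors; there
     both sides are 0. *)
  rewrite Ph /=; have := law_ge0 P X x; have := law_ge0 P Y y.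
  rewrite !le_eqVlt => /predU1P[<-|y0]; first by rewrite !mulr0 !mul0r.
  move=> /predU1P[<-|x0]; first by rewrite !mul0r.
  by rewrite /log2 lnM// mulrDl.
rewrite -(pair_big xpredT xpredT (fun x y : t.-tuple B =>
    law P X x * law P Y y * (log2 (law P X x) + log2 (law P Y y))))/=.
under eq_bigr => x _.
  under eq_bigr do rewrite mulrDr mulrAC -[X in _ + X]mulrA.
  rewrite big_split/= -!mulr_sumr sum_law// mulr1.
  over.
rewrite big_split/= -mulr_suml sum_law// mul1r.
by congr (_ + _); apply: eq_bigr => u _; rewrite Pr_block_law.
Qed.

End RunningKey.

Lemma log2e_EFin {R : realType} (x : R) : 0 < x -> log2e x = (ln x / ln 2)%:E.
Proof. by move=> x0; rewrite /log2e lne_EFin. Qed.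

(** * Typical sets of plaintexts and their size *)

Section TypicalSets.
Context {R : realType} {d : measure_display} {T : measurableType d}.
Variable P : probability T R.
Context {B : finZmodType}.
Variables X Y Z : nat -> T -> B.
Hypotheses (mX : process X) (mY : process Y).
Hypothesis indXY : independent_processes P X Y.
Hypothesis ZE : forall i w, Z i w = X i w + Y i w.
Variable c : R.

Let mZ : process Z := process_cipher mX mY ZE.

(* The product of laws is the joint probability [P(x, z)]; the unknown factor
   [P(z)] cancels in ratios of conditional probabilities. *)
Definition typical (e : R) t (z : t.-tuple B) : {set t.-tuple B} :=
  [set x : t.-tuple B | expR (- ((c + e) * t%:R))
     <= law P X x * law P Y (sub_tuple z x) <= expR (- ((c - e) * t%:R))]%SET.

Lemma typical_subset e e' t (z : t.-tuple B) : e' <= e ->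
  typical e' z \subset typical e z.
Proof.
move=> ee; apply/fintype.subsetP => x; rewrite !inE => /andP[lo hi].
apply/andP; split.
  by apply: le_trans lo; rewrite ler_expR lerN2 ler_wpM2r// lerD2l.
by apply: le_trans hi _; rewrite ler_expR lerN2 ler_wpM2r// lerD2l lerN2.
Qed.

Lemma cond_prob_plaintext t (x z : t.-tuple B) :
  cond_prob P X Z x z = law P X x * law P Y (sub_tuple z x) / law P Z z.
Proof. by rewrite /cond_prob (Pr_plaintext_cipher indXY ZE) Pr_block_law. Qed.

(** With width [e = eps * ln 2 / 3] two log-probabilities differ by at most [2 * e * t] nats, that
    is by two thirds of [eps * t] bits; hence the strict inequality. *)
Lemma typical_ratio (eps : R) t (z x1 x2 : t.-tuple B) : 0 < eps -> (0 < t)%N ->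
  0 < law P Z z ->
  x1 \in typical (eps * ln 2 / 3) z -> x2 \in typical (eps * ln 2 / 3) z ->
  ((t%:R^-1)%:E * `|log2e (cond_prob P X Z x1 z) - log2e (cond_prob P X Z x2 z)|
   < eps%:E)%E.
Proof.
move=> eps0 t0 z0; rewrite !inE !cond_prob_plaintext.
set p1 := law P X x1 * _; set p2 := law P X x2 * _; set e := eps * ln 2 / 3.
move=> /andP[lo1 hi1] /andP[lo2 hi2].
have p10 : 0 < p1 by apply: lt_le_trans lo1; exact: expR_gt0.
have p20 : 0 < p2 by apply: lt_le_trans lo2; exact: expR_gt0.
have l2 : 0 < ln 2 :> R by rewrite ln_gt0// ltr1n.
rewrite !log2e_EFin ?divr_gt0// -EFinB abse_EFin -EFinM lte_fin.
have t0R : 0 < t%:R :> R by rewrite ltr0n.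
rewrite !ln_div ?posrE// -mulrBl opprB addrA subrK.
rewrite normrM (gtr0_norm (_ : 0 < (ln 2)^-1)) ?invr_gt0//.
have H : `|ln p1 - ln p2| <= 2 * e * t%:R.
  have := ler_wln (expR_gt0 _) lo1; have := ler_wln (expR_gt0 _) lo2.
  have := ler_wln p10 hi1; have := ler_wln p20 hi2.
  by rewrite !expRK => h1 h2 h3 h4; rewrite ler_norml; apply/andP; split; lra.
rewrite mulrC ltr_pdivrMr// ltr_pdivrMr//; apply: le_lt_trans H _.
rewrite [ltRHS]mulrAC ltr_pM2r// /e.
have : 0 < eps * ln 2 by rewrite mulr_gt0.
lra.
Qed.

Lemma measurable_typical (e : R) t :
  measurable [set w | block X 0 t w \in typical e (block Z 0 t w)].
Proof.
have := measurable_block 0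
  (fun u : t.-tuple (B * B) => map_tuple fst u \in typical e (map_tuple snd u))
  (process_joint mX mZ).
congr measurable; apply/funext => w /=.
rewrite (_ : map_tuple fst _ = block X 0 t w); last first.
  by apply: eq_from_tnth => i; rewrite tnth_map !tnth_mktuple.
rewrite (_ : map_tuple snd _ = block Z 0 t w)//.
by apply: eq_from_tnth => i; rewrite tnth_map !tnth_mktuple.
Qed.

Section AlmostSure.
Hypothesis asym : forall e, 0 < e ->
  {ae P, forall w, exists N, forall t, (N <= t)%N ->
  block X 0 t w \in typical e (block Z 0 t w)}.

(** Almost surely the plaintext is eventually typical for its own ciphertext, so the conditional
    probability of atypicality becomes small. Given [z], atypicality is the complement of
    [typical e z]. *)
Lemma cond_prob_typical (e delta : R) : 0 < e -> 0 < delta ->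
  {ae P, forall w, exists N, forall t, (N <= t)%N ->
    1 - delta
    <= cond_prob_set P X Z (typical e (block Z 0 t w)) (block Z 0 t w)}.
Proof.
move=> e0 delta0.
pose C t := ~` [set w | block X 0 t w \in typical e (block Z 0 t w)].
have mC t : measurable (C t) by apply: measurableC; exact: measurable_typical.
have Cae : {ae P, forall w, exists N, forall t, (N <= t)%N -> ~ C t w}.
  by apply: filterS (asym e0) => w [N HN]; exists N => t /HN Xt; apply.
have := law_gt0_ae P mZ; have := conditional_probability_cvg0 mZ delta0 mC Cae.
apply: filterS2 => w [N HN] Zpos; exists N => t /HN.
move: (Zpos t); rewrite -tval_block; set z := block Z 0 t w => z0 Cz.
rewrite /cond_prob_set Pr_block_law ler_pdivlMr// mulrBl mul1r lerBlDr.
have mzz : measurable [set w' | block Z 0 t w' = z].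
  exact: (measurable_block 0 (fun u => u = z) mZ).
have mS : measurable [set w | block X 0 t w \in typical e z].
  exact: (measurable_block 0 (fun u => u \in typical e z) mX).
rewrite -{1}(Pr_block_law P Z z).
apply: (@le_trans _ _ (Pr P (([set w | block X 0 t w \in typical e z] `&`
   [set w | block Z 0 t w = z]) `|`
   (C t `&` [set w' | word (trajectory Z w') 0 t = z])))).
  apply: le_Pr => //.
    apply: measurableU; apply: measurableI => //.
    exact: (measurable_word mZ (fun u => u = z)).
  move=> w' /= Zz; have [Xt|Xt] := boolP (block X 0 t w' \in typical e z).
    by left.
  by right; split; [rewrite /C /= Zz; exact/negP|rewrite -tval_block Zz].
apply: le_trans (PrU_le _ _ _) _.
- exact: measurableI.
- apply: measurableI => //; exact: (measurable_word mZ (fun u => u = z)).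
- by rewrite lerD2l.
Qed.

(** Counting inside [typical f] for arbitrarily small [f <= e] keeps the fixed width [e] from
    lowering the rate. The rate [g] of [- ln P(z)] is later [ln #|B|], or the entropy rate of [Z] in
    nats. *)
Lemma log_rate_typical (e g : R) : 0 < e ->
  (forall e', 0 < e' -> {ae P, forall w, exists N, forall t, (N <= t)%N ->
     expR (- ((g + e') * t%:R)) <= law P Z (word (trajectory Z w) 0 t)}) ->
  {ae P, forall w,
    (((c - g) / ln 2)%:E <=
     limn_einf (fun t => log_rate (typical e (block Z 0 t w))))%E}.
Proof.
move=> e0 Hg.
have l2 : 0 < ln 2 :> R by rewrite ln_gt0// ltr1n.
suff : {ae P, forall w, forall e', 0 < e' -> exists N, forall t, (N <= t)%N ->
    (((c - g) / ln 2 - e')%:E <= log_rate (typical e (block Z 0 t w)))%E}.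
  by apply: filterS => w H; apply: limn_einf_ge.
apply: ae_forall_inv => /= [e1 e2 w e10 e12 [N HN]|e1 e10].
  exists N => t /HN; apply: le_trans.
  by rewrite lee_fin lerD2l lerN2.
(* Three losses of at most [f * t] arise, from the law of [z], the width of [typical f] and the mass
   1/2; together they stay within [e1 * ln 2 * t]. *)
pose f := Num.min e (e1 * ln 2 / 3).
have f0 : 0 < f by rewrite lt_min e0 divr_gt0// mulr_gt0.
have half0 : 0 < 2^-1 :> R by rewrite invr_gt0.
have := cond_prob_typical f0 half0; have := Hg _ f0; have := law_gt0_ae P mZ.
have [N1 HN1] := exists_nat_ge (ln 2 / f).
apply: filterS3 => w Zpos [N2 HN2] [N3 HN3].
exists (maxn N1.+1 (maxn N2 N3)) => t; rewrite !geq_max => /and3P[t1 t2 t3].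
have t0 : (0 < t)%N by rewrite (leq_trans _ t1).
have t0R : 0 < t%:R :> R by rewrite ltr0n.
have := HN3 _ t3; have := HN2 _ t2; have := Zpos t; rewrite -tval_block.
set z := block Z 0 t w => z0 zlo.
rewrite /cond_prob_set Pr_block_law ler_pdivlMr//.
have mzz : measurable [set w' | block Z 0 t w' = z].
  exact: (measurable_block 0 (fun u => u = z) mZ).
rewrite Pr_blockI// => mass.
have card_ge : (1 - 2^-1) * law P Z z <=
    #|typical e z|%:R * expR (- ((c - f) * t%:R)).
  apply: le_trans mass _.
  apply: (@le_trans _ _ (\sum_(x in typical f z) expR (- ((c - f) * t%:R)))).
    apply: ler_sum => x; rewrite inE (Pr_plaintext_cipher indXY ZE).
    by case/andP.
  rewrite sumr_const -[leLHS]mulr_natl ler_wpM2r ?expR_ge0// ler_nat.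
  by apply: subset_leq_card; apply: typical_subset; rewrite ge_min lexx.
have N0 : 0 < #|typical e z|%:R :> R.
  rewrite -(pmulr_lgt0 _ (expR_gt0 (- ((c - f) * t%:R)))).
  by apply: lt_le_trans card_ge; rewrite mulr_gt0//; lra.
rewrite /log_rate log2e_EFin// -EFinM lee_fin.
have h0 : 0 < 1 - 2^-1 :> R by lra.
have := ler_wln (mulr_gt0 h0 z0) card_ge.
rewrite (lnM h0 z0) (lnM N0 (expR_gt0 _)) expRK.
have -> : ln (1 - 2^-1) = - ln 2 :> R.
  by rewrite -lnV ?posrE//; congr ln; lra.
have := ler_wln (expR_gt0 _) zlo; rewrite expRK.
have : ln 2 <= f * t%:R.
  rewrite mulrC -ler_pdivrMr//; apply: le_trans HN1 _.
  by rewrite ler_nat ltnW.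
move: (ln #|typical e z|%:R) (ln (law P Z z)) => S L hf hL hS.
rewrite [leRHS]mulrC ler_pdivlMr// ler_pdivlMr//.
have -> : ((c - g) / ln 2 - e1) * t%:R * ln 2 =
    (c - g) * t%:R - e1 * ln 2 * t%:R by field; rewrite gt_eqF.
have f3 : 3 * f <= e1 * ln 2.
  have : f <= e1 * ln 2 / 3 by rewrite ge_min lexx orbT.
  lra.
have := ler_wpM2r (ltW t0R) f3.
lra.
Qed.

End AlmostSure.
End TypicalSets.

(** Stated over a finite abelian group, where the key is recovered by subtraction. *)
Theorem running_key {R : realType} {d : measure_display} {T : measurableType d}
    (P : probability T R) (B : finZmodType) (X Y Z : nat -> T -> B)
    (eps delta : R) :
  process X -> process Y ->
  stationary P X -> ergodic P X -> stationary P Y -> ergodic P Y ->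
  independent_processes P X Y -> (forall i w, Z i w = X i w + Y i w) ->
  0 < eps -> 0 < delta ->
  exists Psi : forall t : nat, t.-tuple B -> {set t.-tuple B},
    {ae P, forall w : T,
      let z := fun t => block Z 0 t w in
      (exists n' : nat, forall t : nat, (n' < t)%N ->
         1 - delta < cond_prob_set P X Z (Psi t (z t)) (z t) /\
         (forall x1 x2 : t.-tuple B,
            x1 \in Psi t (z t) -> x2 \in Psi t (z t) ->
            ((t%:R^-1)%:E * `|log2e (cond_prob P X Z x1 (z t))
                              - log2e (cond_prob P X Z x2 (z t))|
             < eps%:E)%E)) /\
      (ergodic P Z ->
         ((cond_entropy P X Z)%:E
            <= limn_einf (fun t => log_rate (Psi t (z t))))%E) /\
      ((entropy P X + entropy P Y - log2 #|B|%:R)%:E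
         <= limn_einf (fun t => log_rate (Psi t (z t))))%E}.
Proof.
move=> mX mY sX eX sY eY indXY ZE eps0 delta0.
have mZ := process_cipher mX mY ZE.
have sZ := stationary_cipher mX mY sX sY indXY ZE.
have [cX [cX0 asX limX]] := shannon_mcmillan_breiman mX sX eX.
have [cY [cY0 asY limY]] := shannon_mcmillan_breiman mY sY eY.
have l2 : 0 < ln 2 :> R by rewrite ln_gt0// ltr1n.
pose c := cX + cY; pose e := eps * ln 2 / 3.
have e0 : 0 < e by rewrite divr_gt0// mulr_gt0.
have asym e' : 0 < e' -> {ae P, forall w, exists N, forall t, (N <= t)%N ->
    block X 0 t w \in typical P X Y c e' (block Z 0 t w)}.
  (* Half of the width goes to [X] and half to [Y]; rates and tolerances add up in the product of
     the laws. *)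
  move=> e'0; have e2 : 0 < e' / 2 by rewrite divr_gt0.
  have := asY _ e2; have := asX _ e2; apply: filterS2 => w [N1 H1] [N2 H2].
  exists (maxn N1 N2) => t; rewrite geq_max.
  move=> /andP[/H1/andP[lX uX] /H2/andP[lY uY]].
  rewrite inE -(block_cipher ZE) !tval_block.
  have E s : expR (- ((c + s) * t%:R)) =
      expR (- ((cX + s / 2) * t%:R)) * expR (- ((cY + s / 2) * t%:R)).
    by rewrite -expRD; congr expR; rewrite /c; field.
  by rewrite !E !mulNr !ler_pM ?expR_ge0 ?law_ge0.
exists (fun t z => typical P X Y c e z).
have gE : {ae P, forall w, ergodic P Z -> ((cond_entropy P X Z)%:E <=
    limn_einf (fun t => log_rate (typical P X Y c e (block Z 0 t w))))%E}.
  (* Ergodicity of [Z] does not depend on [w], so the cases are separated outside the almost sure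
     statement. *)
  have [eZ|neZ] := pselect (ergodic P Z); last by apply: aeW => w /neZ.
  have [cZ [cZ0 asZ limZ]] := shannon_mcmillan_breiman mZ sZ eZ.
  have -> : cond_entropy P X Z = (c - cZ) / ln 2.
    apply/cvg_lim => //; rewrite /c mulrBl mulrDl.
    rewrite (_ : cond_entropy_m P X Z =
      fun m => entropy_m P X m + entropy_m P Y m - entropy_m P Z m).
      by apply: cvgB => //; exact: cvgD.
    apply/funext => m; rewrite /cond_entropy_m.
    by rewrite (entropy_m_plaintext_cipher mX mY indXY ZE).
  have loZ e' : 0 < e' -> {ae P, forall w, exists N, forall t, (N <= t)%N ->
      expR (- ((cZ + e') * t%:R)) <= law P Z (word (trajectory Z w) 0 t)}.
    by move=> /asZ; apply: filterS => w [N HN]; exists N => t /HN/andP[].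
  by apply: filterS (log_rate_typical mX mY indXY ZE asym e0 loZ) => w + _.
have gU := log_rate_typical mX mY indXY ZE asym e0
  (fun e' e'0 => law_ge_uniform P mZ e'0).
have delta2 : 0 < delta / 2 by rewrite divr_gt0.
have gC := cond_prob_typical mX mY ZE asym e0 delta2.
have gZ := law_gt0_ae P mZ.
apply: filterS3 (filterI gZ gC) gE gU => w [Zpos [N HN]] gEw gUw.
split; [|split=> //].
- exists N => t Nt; split; first by apply: lt_le_trans (HN _ (ltnW Nt)); lra.
  move=> x1 x2; apply: typical_ratio => //; first by rewrite (leq_trans _ Nt).
  by rewrite tval_block; exact: Zpos.
- rewrite /entropy (cvg_lim _ limX)// (cvg_lim _ limY)// /log2 -mulrDl -mulrBl.
  exact: gUw.
Qed.

Theorem corollary1 (R : realType) (d : measure_display) (T : measurableType d)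
    (P : probability T R) (n : nat) (hn : (2 <= n)%N)
    (X Y Z : nat -> T -> 'I_n)
    (mX : process X) (mY : process Y)
    (sX : stationary P X) (eX : ergodic P X)
    (sY : stationary P Y) (eY : ergodic P Y)
    (indXY : independent_processes P X Y)
    (cipher : forall i w, nat_of_ord (Z i w) = ((X i w + Y i w) %% n)%N)
    (eps delta : R) (heps : 0 < eps) (hdelta : 0 < delta) :
  exists Psi : forall t : nat, t.-tuple 'I_n -> {set t.-tuple 'I_n},
    {ae P, forall w : T,
      let z := fun t => block Z 0 t w in
      (exists n' : nat, forall t : nat, (n' < t)%N ->
         1 - delta < cond_prob_set P X Z (Psi t (z t)) (z t) /\
         (forall x1 x2 : t.-tuple 'I_n,
            x1 \in Psi t (z t) -> x2 \in Psi t (z t) ->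
            ((t%:R^-1)%:E * `|log2e (cond_prob P X Z x1 (z t))
                              - log2e (cond_prob P X Z x2 (z t))|
             < eps%:E)%E)) /\
      (ergodic P Z ->
         ((cond_entropy P X Z)%:E
            <= limn_einf (fun t => log_rate (Psi t (z t))))%E) /\
      ((entropy P X + entropy P Y - log2 n%:R)%:E
         <= limn_einf (fun t => log_rate (Psi t (z t))))%E}.
Proof.
(* Once [n] is a successor, ['I_n] is the cyclic group of order [n], whose addition is that of the
   cipher. *)
case: n hn X Y Z mX mY sX eX sY eY indXY cipher => // n _ X Y Z mX mY.
move=> sX eX sY eY indXY cipher.
have ZE i w : Z i w = X i w + Y i w by apply: val_inj; rewrite /= cipher.
have [Psi] := running_key mX mY sX eX sY eY indXY ZE heps hdelta.
by rewrite card_ord; exists Psi.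
Qed.
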